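(* Let $p,q,r$ be distinct primes. Suppose $X$ is an indecomposable cycle set with $\mathrm{mpl}(X)=3$, $|X|=pqr$ and $X^{(1)}=\mathbb{Z}_p\times_\Gamma\mathbb{Z}_q$, where $\Gamma^0=\Gamma(0,-):\mathbb{Z}_p\to\mathbb{Z}_q$ is nonzero but not proportional to a character, and where $\Gamma$ is normalized such that $\Gamma^0(-x_0)=1$ for some $x_0\in\mathbb{Z}_p$. Then: (1) either $X\cong\mathbb{Z}_p\times\mathbb{Z}_q\times\mathbb{Z}_r$ with the operation $$(x,a,s)\ast(y,b,t)=\begin{cases}(y+1,\ b+\Gamma^0(y-x),\ t+\Phi^0_1(b-a)) & x=y,\\ (y+1,\ b+\Gamma^0(y-x),\ t+\Phi^0_2(x-y)) & x\neq y,\end{cases}$$ where $\Phi^0_1:\mathbb{Z}_q\to\mathbb{Z}_r$ and $\Phi^0_2:\mathbb{Z}_p^{\ast}\to\mathbb{Z}_r$ are maps that are not both identically zero; (2) or $X\cong\mathbb{Z}_p\times\mathbb{Z}_q\times\mathbb{Z}_r$ with the operation $$(x,a,s)\ast(y,b,t)=\Bigl(y+1,\ b+\Gamma^0(y-x),\ \chi_y(\Gamma_x)\cdot\bigl(t+\chi_{y-x}(a\cdot\Gamma_{x_0})\cdot\Phi^0(y-x,\ b-a\cdot\Gamma_{x_0}(y-x))\bigr)\Bigr).$$ Here $x_0$ is such that $\Gamma^0(-x_0)=1$; $\chi=\chi_0:K\to\mathbb{Z}_r^{\ast}$ is a character whose restriction to $K_0$ is not identically $1$; and with $$\mathcal{N}_\chi=\{x\in\mathbb{Z}_p:\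 \forall f\in K_0:\ f(x)=0\Rightarrow\chi_x(f)=1\},$$ we have $\Phi^0=\sum_{x\in\mathcal{N}_\chi}c_x\phi^0_x$ with $c_x\in\mathbb{Z}_r$, not all $0$, where $\phi^0_x:\mathbb{Z}_p\times\mathbb{Z}_q\to\mathbb{Z}_r$ is given by $$\phi^0_x(y,a)=\begin{cases}0 & x\neq y,\\ \chi_x(f) & x=y,\ \text{where } f\in K_0 \text{ satisfies } f(x)=a.\end{cases}$$ In both cases, the conditions for $\Phi^0_1,\Phi^0_2$, resp. $\Phi^0$, are sufficient for the given operation to define an indecomposable cycle set on $\mathbb{Z}_p\times\mathbb{Z}_q\times\mathbb{Z}_r$ (which might be of multipermutation level $<3$).
   Context: A cycle set is a finite set $X$ with a binary operation $\ast$ such that $(x\ast y)\ast(x\ast z)=(y\ast x)\ast(y\ast z)$ for all $x,y,z\in X$, each map $\sigma_x: y\mapsto x\ast y$ is bijective, and $x\mapsto x\ast x$ is bijective (all cycle sets are assumed finite and nondegenerate). $X$ is indecomposable if it has no partition into two nonempty sub-cycle sets; equivalently $\mathcal{G}(X)=\langle\sigma_x:x\in X\rangle\leq\mathrm{Sym}(X)$ acts transitively on $X$. The retraction $X^{(1)}=X_{\mathrm{ret}}$ is the quotient of $X$ by $x\sim y\Leftrightarrow\sigma_x=\sigma_y$, with operation $[x]\ast[y]=[x\ast y]$. With $X^{(0)}=X$ and $X^{(n+1)}=(X^{(n)})_{\mathrm{ret}}$, $\mathrm{mpl}(X)$ is the least $n\ge0$ with $|X^{(n)}|=1$ (and $\infty$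 if none exists). $\mathbb{Z}_n=\mathbb{Z}/n\mathbb{Z}$; for a prime $\ell$, $\mathbb{Z}_\ell^{\ast}=\mathbb{Z}_\ell\setminus\{0\}$. For $\Gamma:\mathbb{Z}_p\times\mathbb{Z}_p\to\mathbb{Z}_q$ with $\Gamma(x,y)=\Gamma^0(y-x)$, $\mathbb{Z}_p\times_\Gamma\mathbb{Z}_q$ is the cycle set on $\mathbb{Z}_p\times\mathbb{Z}_q$ with operation $(x,a)\ast(y,b)=(y+1,b+\Gamma^0(y-x))$; $X^{(1)}=\mathbb{Z}_p\times_\Gamma\mathbb{Z}_q$ is understood up to isomorphism. $\Gamma^0$ is proportional to a character if $\Gamma^0=\alpha\cdot\psi$ for some $\alpha\in\mathbb{Z}_q^{\ast}$ and some $\psi:\mathbb{Z}_p\to\mathbb{Z}_q^{\ast}$ with $\psi(x+y)=\psi(x)\psi(y)$. For $x\in\mathbb{Z}_p$ define $\Gamma_x:\mathbb{Z}_p\to\mathbb{Z}_q$ by $\Gamma_x(y)=\Gamma(x,y)=\Gamma^0(y-x)$. Let $K=\langle\Gamma_x:x\in\mathbb{Z}_p\rangle\leq\mathbb{Z}_q^{\mathbb{Z}_p}$ (additive subgroup) and $K_0=\{f\in K:f(0)=0\}$. The characters in (2) are given as follows: there are elements $\xi_y\in\mathbb{Z}_r^{\ast}$ ($y\in\mathbb{Z}_p^{\ast}$) with $\xi_y^q=1$, and for $x\in\mathbb{Z}_p$, $$\chi_x:K\to\mathbb{Z}_r^{\ast},\qquad \chi_x(f)=\prod_{y\in\mathbb{Z}_p^{\ast}}\xi_y^{f(y+x)},$$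 with $\chi=\chi_0$. *)

(* Defs.v *)
From HB Require Import structures.
From mathcomp Require Import all_boot all_order all_fingroup all_algebra.
From mathcomp Require Import generic_quotient.

Set Implicit Arguments.
Unset Strict Implicit.
Unset Printing Implicit Defensive.

Import GRing.Theory.
Local Open Scope ring_scope.
Local Open Scope quotient_scope.

Definition is_cycle_set (T : finType) (op : T -> T -> T) : Prop :=
  [/\ forall x y z, op (op x y) (op x z) = op (op y x) (op y z),
      forall x, bijective (op x)
    & bijective (fun x => op x x)].

Record cycleSet := CycleSet {
  cs_sort :> finType;
  cs_op : cs_sort -> cs_sort -> cs_sort;
  cs_axiom : is_cycle_set cs_op }.

(* As T is finite, a subset closed under the operation of a cycle set is a
   cycle set for the restricted operation. *)
Definition op_closed (T : finType) (op : T -> T -> T) (A : {set T}) : Prop :=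
  forall x y, x \in A -> y \in A -> op x y \in A.

Definition indecomposable (T : finType) (op : T -> T -> T) : Prop :=
  ~ exists A B : {set T},
      [/\ A != set0, B != set0, A :&: B = set0 & A :|: B = setT]
      /\ (op_closed op A /\ op_closed op B).

Definition op_isomorphic (T U : Type) (opT : T -> T -> T) (opU : U -> U -> U)
    : Prop :=
  exists f : T -> U, bijective f /\ forall x y, f (opT x y) = opU (f x) (f y).

Section Retraction.

Variable X : cycleSet.
Let op := @cs_op X.

Definition ret_rel : rel X := [rel x y | [forall z, op x z == op y z]].

Lemma ret_relP x y : reflect (op x =1 op y) (ret_rel x y).
Proof. exact: eqfunP. Qed.

Lemma ret_rel_equiv : equiv_class_of ret_rel.
Proof.
split=> [x | x y | y x z].
- exact/ret_relP.
- by apply/ret_relP/ret_relP => H z; rewrite H.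
- by move=> /ret_relP Hxy /ret_relP Hyz; apply/ret_relP => t; rewrite Hxy Hyz.
Qed.

Canonical ret_equiv := EquivRelPack ret_rel_equiv.

Definition ret_type := {eq_quot ret_rel}.
HB.instance Definition _ := Quotient.on ret_type.
HB.instance Definition _ := [Finite of ret_type by <:%/].

Lemma ret_piP x y : \pi_ret_type x = \pi_ret_type y <-> op x =1 op y.
Proof.
split=> [/(@eqquotP _ ret_rel)/ret_relP // | H].
by apply/eqquotP/ret_relP.
Qed.

Definition ret_op (u v : ret_type) : ret_type :=
  \pi_ret_type (op (repr u) (repr v)).

Lemma ret_op_congr x x' y y' :
  op x =1 op x' -> op y =1 op y' -> op (op x y) =1 op (op x' y').
Proof.
have [cyc bij _] := cs_axiom X; move=> Hx Hy w.
have [g _ gK] := bij x; rewrite Hx -[w]gK -/op -Hx [LHS]cyc.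
by rewrite -/op !Hy -[LHS]cyc -/op !Hx.
Qed.

Lemma ret_opE x y :
  ret_op (\pi_ret_type x) (\pi_ret_type y) = \pi_ret_type (op x y).
Proof.
have repr_rel t : op (repr (\pi_ret_type t)) =1 op t.
  by apply/ret_piP; apply: reprK.
by apply/ret_piP/ret_op_congr; apply: repr_rel.
Qed.

Lemma ret_axiom : is_cycle_set ret_op.
Proof.
have [cyc bij diag] := cs_axiom X.
have surj_bij (f : ret_type -> ret_type) : (forall v, exists u, f u = v) ->
  bijective f.
  move=> surj; have ex v : exists u, f u == v.
    by have [u <-] := surj v; exists u.
  have fK : cancel (fun v => xchoose (ex v)) f.
    by move=> v; apply/eqP/(xchooseP (ex v)).
  exact: (bij_can_bij (injF_bij (can_inj fK)) fK).
split.
- elim/quotW=> x; elim/quotW=> y; elim/quotW=> z.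
  by rewrite !ret_opE; congr (\pi _); apply: cyc.
- elim/quotW=> x; apply: surj_bij; elim/quotW=> y.
  have [g _ gK] := bij x.
  by exists (\pi_ret_type (g y)); rewrite ret_opE /op gK.
- apply: surj_bij; elim/quotW=> y; have [g _ gK] := diag.
  by exists (\pi_ret_type (g y)); rewrite ret_opE /op gK.
Qed.

Definition ret : cycleSet := CycleSet ret_axiom.

End Retraction.

Definition has_mpl (X : cycleSet) (n : nat) : Prop :=
  #|iter n ret X| = 1%N /\ forall m, (m < n)%N -> #|iter m ret X| <> 1%N.

Definition ext_op (p q : nat) (Gam0 : 'F_p -> 'F_q) (u v : 'F_p * 'F_q)
    : 'F_p * 'F_q :=
  let: (x, a) := u in let: (y, b) := v in (y + 1, b + Gam0 (y - x)).

Definition proportional_to_character (p q : nat) (Gam0 : 'F_p -> 'F_q)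
    : Prop :=
  exists (alpha : 'F_q) (psi : 'F_p -> 'F_q),
    [/\ alpha != 0, forall x, psi x != 0,
        forall x y, psi (x + y) = psi x * psi y
      & forall x, Gam0 x = alpha * psi x].

(* The value of Phi2 at 0 is irrelevant: Phi2 stands for a map on the nonzero
   elements of 'F_p. *)
Definition op1 (p q r : nat) (Gam0 : 'F_p -> 'F_q) (Phi1 : 'F_q -> 'F_r)
    (Phi2 : 'F_p -> 'F_r) (u v : 'F_p * 'F_q * 'F_r) : 'F_p * 'F_q * 'F_r :=
  let: (x, a, s) := u in let: (y, b, t) := v in
  (y + 1, b + Gam0 (y - x),
   if x == y then t + Phi1 (b - a) else t + Phi2 (x - y)).

Definition cond1 (p q r : nat) (Phi1 : 'F_q -> 'F_r) (Phi2 : 'F_p -> 'F_r)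
    : Prop :=
  ~ ((forall b, Phi1 b = 0) /\ (forall x, x != 0 -> Phi2 x = 0)).

(* Builds the missing finGroupType structure on finite functions from the
   existing pointwise group structure. The group law of 'F_q is its addition,
   so << _ >> below is the generated additive subgroup. *)
HB.saturate finfun_of.

Lemma ffun_mulgE (p q : nat) (f g : {ffun 'F_p -> 'F_q}) :
  (f * g)%g = f + g.
Proof. by []. Qed.

Section Characters.

Variables (p q r : nat) (Gam0 : 'F_p -> 'F_q).

Definition Gam (x : 'F_p) : {ffun 'F_p -> 'F_q} := [ffun y => Gam0 (y - x)].

Definition K : {set {ffun 'F_p -> 'F_q}} := <<[set Gam x | x : 'F_p]>>%g.

Definition K0 : {set {ffun 'F_p -> 'F_q}} := [set f in K | f 0 == 0].

(* Only the values xi y with y != 0 matter. *)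
Variable xi : 'F_p -> 'F_r.

Definition xi_roots : Prop :=
  forall y, y != 0 -> xi y != 0 /\ xi y ^+ q = 1.

(* The exponent is the representative in {0, ..., q-1} of an element of 'F_q;
   under xi_roots any other representative gives the same power. *)
Definition chi (x : 'F_p) (f : {ffun 'F_p -> 'F_q}) : 'F_r :=
  \prod_(y : 'F_p | y != 0) xi y ^+ nat_of_ord (f (y + x)).

Definition Nchi : {set 'F_p} :=
  [set x | [forall f in K0, (f x == 0) ==> (chi x f == 1)]].

(* For x in Nchi the value chi x f does not depend on the choice of f. *)
Definition phi0 (x y : 'F_p) (a : 'F_q) : 'F_r :=
  if x == y then
    if [pick f in K0 | f x == a] is Some f then chi x f else 0
  else 0.

Definition Phi0 (c : 'F_p -> 'F_r) (y : 'F_p) (a : 'F_q) : 'F_r :=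
  \sum_(x in Nchi) c x * phi0 x y a.

Definition cond2 (c : 'F_p -> 'F_r) : Prop :=
  [/\ xi_roots, exists2 f, f \in K0 & chi 0 f != 1
    & exists2 x, x \in Nchi & c x != 0].

Definition op2 (x0 : 'F_p) (c : 'F_p -> 'F_r) (u v : 'F_p * 'F_q * 'F_r)
    : 'F_p * 'F_q * 'F_r :=
  let: (x, a, s) := u in let: (y, b, t) := v in
  (y + 1, b + Gam0 (y - x),
   chi y (Gam x) *
     (t + chi (y - x) [ffun z => a * Gam x0 z]
          * Phi0 c (y - x) (b - a * Gam x0 (y - x)))).

End Characters.

(* Main.v *)
Require Import Defs.
From mathcomp Require Import all_boot all_order all_fingroup all_algebra.
From mathcomp Require Import generic_quotient ring.
Import GRing.Theory.
Local Open Scope ring_scope.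

Set Implicit Arguments.
Unset Strict Implicit.
Unset Printing Implicit Defensive.

(* Let Y = 'F_p * 'F_q, and for u in Y let lam u be the common value of sigma_x
   for the x in X over u. Conjugation by lam (x, a) maps each
   lam (y, b) (lam (y, b'))^-1 to an element of the same kind that does not
   depend on a. So these elements generate an abelian normal subgroup N0 of
   G(X), which is transitive on the fibres of X -> Y; as these have prime size
   r, we get X = Y * 'F_r with lam (x, a) (w, t) = (x . w, m_x(w) (t + n_(x,a)(w))).

   Let Psi u w be n u w minus its mean over the second coordinate of u, scaled
   by q. Then Psi (x . u) (x . w) = m_x(w) Psi u w, and no function Psi _ w is
   zero. Hence m extends to a cocycle of the group G(Y), the semidirect product
   of K and 'F_p, and rescaling the fibres turns it into chi. The order p |K| of
   G(Y) is prime to r, so averaging over G(Y) replaces n, up to a coboundary, by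
   an equivariant function. Since Gam0 is not proportional to a character, K
   takes all pairs of values at two distinct points, so an equivariant function
   has the form (1) if chi is trivial on K0, and the form (2) otherwise.

   Conversely, an equivariant Psi defines a cycle set. If it were decomposable,
   the barycentres of the fibres of an invariant subset would form an invariant
   section, and averaging this section over G(Y) shows that Psi = 0. *)

(** * Transitive families of maps *)

Section Transitivity.

(** For injective maps of a finite set, an invariant subset is a union of orbits of the generated
    group, so this is transitivity of that group, phrased without inverses. *)
Definition transitive_family (I : Type) (W : finType) (g : I -> W -> W)
    : Prop :=
  forall A : {set W}, (forall i w, w \in A -> g i w \in A) ->
    A = set0 \/ A = setT.

(** In a decomposition into [A] and [B], an element [u] of [B] makes [op u] permute the finite set
    [B], hence preserve its complement [A]. So [A] is invariant under every [op u]. *)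
Lemma transitive_indecomposable (T : finType) (op : T -> T -> T) :
  (forall x, injective (op x)) -> transitive_family op -> indecomposable op.
Proof.
move=> opI tr [A [B [[A0 B0 AB0 ABT] [clA clB]]]].
have BE : B = ~: A.
  apply/setP=> z; have /setP/(_ z) := ABT; have /setP/(_ z) := AB0.
  by rewrite !inE; case: (z \in A); case: (z \in B).
have [u v vA|AE|AE] := tr A _; last 2 first.
- by rewrite AE eqxx in A0.
- by rewrite BE AE setCT eqxx in B0.
have [uA|uA] := boolP (u \in A); first exact: clA.
have uB : op u @: B = B.
  apply/eqP; rewrite eqEcard card_imset // leqnn andbT.
  apply/subsetP=> _ /imsetP[z zB ->]; apply: clB => //.
  by rewrite BE inE.
apply: contraT => uvA; have : op u v \in op u @: B by rewrite uB BE inE.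
by rewrite mem_imset // BE inE vA.
Qed.

Lemma indecomposable_transitive (T : finType) (op : T -> T -> T) :
  (forall x, injective (op x)) -> indecomposable op -> transitive_family op.
Proof.
move=> opI ind A invA.
have [->|A0] := eqVneq A set0; first by left.
have [->|AT] := eqVneq A setT; first by right.
case: ind; exists A, (~: A); split; first split=> //.
- by rewrite -setCT (inj_eq (@setC_inj T)).
- exact: setICr.
- exact: setUCr.
split=> [u v _|u v _]; first exact: invA.
rewrite !inE => vA; apply: contra vA => uvA.
have uA : op u @: A = A.
  apply/eqP; rewrite eqEcard card_imset // leqnn andbT.
  by apply/subsetP=> _ /imsetP[z zA ->]; apply: invA.
by move: uvA; rewrite -{1}uA mem_imset.
Qed.

(** The set where [k] is at least [k w] is invariant and contains [w], so it is everything. *)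
Lemma transitive_nondecreasing (I : Type) (W : finType) (g : I -> W -> W)
    (k : W -> nat) :
  transitive_family g -> (forall i w, (k w <= k (g i w))%N) ->
  forall w w', k w = k w'.
Proof.
move=> tr mono; suff le w w' : (k w <= k w')%N.
  by move=> w w'; apply/eqP; rewrite eqn_leq !le.
have [i v|/setP/(_ w)|/setP/(_ w')] := tr [set v | (k w <= k v)%N] _.
- by rewrite !inE => /leq_trans; apply.
- by rewrite !inE leqnn.
- by rewrite !inE.
Qed.

Lemma Fp_natr_eq0 (r n : nat) : prime r -> (n%:R == 0 :> 'F_r) = (r %| n)%N.
Proof. by move=> rP; rewrite -(dvdn_pcharf (pchar_Fp rP)). Qed.

(* If A is a nontrivial invariant set then its fibres have a common size k with
   0 < k < r, and their barycentres form an invariant section. *)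
Lemma transitive_affine_bundle (I : Type) (W : finType) (r : nat)
    (g : I -> W -> W) (m n : I -> W -> 'F_r) :
  prime r -> transitive_family g -> (forall i w, m i w != 0) ->
  (forall h : W -> 'F_r, ~ forall i w, h (g i w) = m i w * h w + n i w) ->
  transitive_family
    (fun i (v : W * 'F_r) => (g i v.1, m i v.1 * v.2 + n i v.1)).
Proof.
move=> rP tr m0 nosec A invA.
pose F w := [set t | (w, t) \in A].
have affI i w : injective (fun t => m i w * t + n i w).
  by move=> t t' /addIr /(mulfI (m0 i w)).
have sub i w : [set m i w * t + n i w | t in F w] \subset F (g i w).
  apply/subsetP=> _ /imsetP[t + ->]; rewrite !inE; exact: (invA i (w, t)).
have Fcst : forall w w', #|F w| = #|F w'|.
  apply: (transitive_nondecreasing (k := fun w => #|F w|) tr) => i w.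
  by rewrite -(card_imset _ (affI i w)); apply: subset_leq_card.
have FE i w : F (g i w) = [set m i w * t + n i w | t in F w].
  by apply/esym/eqP; rewrite eqEcard sub card_imset //= (Fcst w (g i w)).
have [w0|W0] := pickP W; last first.
  by left; apply/setP=> -[w t]; have := W0 w.
have [F0|F0] := posnP #|F w0|.
  left; apply/setP=> -[w t]; rewrite inE; apply/negP=> wtA.
  have /setP/(_ t) : F w = set0 by apply/eqP; rewrite -cards_eq0 (Fcst w w0) F0.
  by rewrite !inE wtA.
have [Fr|Fr] := ltnP #|F w0| r; last first.
  right; apply/setP=> -[w t]; rewrite inE.
  have /setP/(_ t) : F w = setT.
    apply/eqP; rewrite eqEcard subsetT /= cardsT card_Fp //.
    by rewrite (Fcst w w0).
  by rewrite !inE.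
have k0 : #|F w0|%:R != 0 :> 'F_r.
  by rewrite Fp_natr_eq0 // gtnNdvd.
case: (nosec (fun w => (\sum_(t in F w) t) / #|F w0|%:R)) => i w.
rewrite FE big_imset /=; last by move=> t t' _ _ /affI.
rewrite big_split /= -mulr_sumr sumr_const (Fcst w w0) -[n i w *+ _]mulr_natr.
by rewrite mulrDl mulrA mulfK.
Qed.

End Transitivity.

(** * The group of the translations by K and by the shift *)

Section Cocycles.

Variables p q : nat.
Hypotheses (p_prime : prime p) (q_prime : prime q).
Variable Gam0 : 'F_p -> 'F_q.

Local Notation fpq := {ffun 'F_p -> 'F_q}.
Local Notation Y := ('F_p * 'F_q)%type.
Local Notation Gm := (Gam Gam0).
Local Notation KG := (K Gam0).

Definition shift (i : 'F_p) (f : fpq) : fpq := [ffun y => f (y + i)].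

Definition scale (a : 'F_q) (f : fpq) : fpq := [ffun y => a * f y].

(** The action on Y of the element [(i, f)] of the semidirect product of functions and 'F_p;
    [translate_comp] is its group law. *)
Definition translate (i : 'F_p) (f : fpq) (w : Y) : Y := (w.1 + i, w.2 + f w.1).

Lemma shiftE i f y : shift i f y = f (y + i). Proof. by rewrite ffunE. Qed.

Lemma shift0 f : shift 0 f = f.
Proof. by apply/ffunP=> y; rewrite shiftE addr0. Qed.

Lemma shift_shift i j f : shift i (shift j f) = shift (i + j) f.
Proof. by apply/ffunP=> y; rewrite !shiftE addrA. Qed.

Lemma shiftD i f g : shift i (f + g) = shift i f + shift i g.
Proof. by apply/ffunP=> y; rewrite !(ffunE, shiftE). Qed.

Lemma shift_Gam i x : shift i (Gm x) = Gm (x - i).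
Proof. by apply/ffunP=> y; rewrite !ffunE; congr Gam0; ring. Qed.

Lemma translate_comp i f j h w :
  translate i f (translate j h w) = translate (j + i) (h + shift j f) w.
Proof. by rewrite /translate /= !ffunE !addrA. Qed.

Lemma translateK i f :
  cancel (translate i f) (translate (- i) (- shift (- i) f)).
Proof.
by case=> y b; rewrite /translate /= !ffunE !addrK.
Qed.

Lemma translate_inj i f : injective (translate i f).
Proof. exact: can_inj (translateK i f). Qed.

Lemma translateVK i f :
  cancel (translate (- i) (- shift (- i) f)) (translate i f).
Proof. by case=> y b; rewrite /translate /= !ffunE !subrK. Qed.

Lemma ext_opE (u w : Y) : ext_op Gam0 u w = translate 1 (Gm u.1) w.
Proof. by case: u w => [x a] [y b]; rewrite /translate /= ffunE. Qed.

Lemma KD f g : f \in KG -> g \in KG -> f + g \in KG.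
Proof. by move=> fK gK; rewrite -ffun_mulgE groupM. Qed.

Lemma K_0 : (0 : fpq) \in KG. Proof. exact: group1. Qed.

Lemma K_Gam x : Gm x \in KG.
Proof. by rewrite /K mem_gen // imset_f. Qed.

Lemma K_natmul f n : f \in KG -> f *+ n \in KG.
Proof. by move=> fK; elim: n => [|n IH]; rewrite ?K_0 // mulrS KD. Qed.

Lemma scale_natmul a f : scale a f = f *+ a.
Proof.
by apply/ffunP=> y; rewrite !ffunE ffunMnE -mulr_natl natr_Zp.
Qed.

Lemma K_scale a f : f \in KG -> scale a f \in KG.
Proof. by move=> fK; rewrite scale_natmul K_natmul. Qed.

Lemma KN f : f \in KG -> - f \in KG.
Proof.
move=> fK; have -> : - f = scale (-1) f; last exact: K_scale.
by apply/ffunP=> y; rewrite !ffunE mulN1r.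
Qed.

Lemma K_ind (P : fpq -> Prop) :
  P 0 -> (forall f x, P f -> P (f + Gm x)) -> forall f, f \in KG -> P f.
Proof.
move=> P0 PD _ /gen_prodgP[n [c cA ->]].
elim: n c cA => [|n IH] c cA; first by rewrite big_ord0.
rewrite big_ord_recr /=; have /imsetP[x _ ->] := cA ord_max.
by apply: PD; apply: IH.
Qed.

Lemma K_shift i f : f \in KG -> shift i f \in KG.
Proof.
elim/K_ind=> [|f' x IH]; last by rewrite shiftD KD // shift_Gam K_Gam.
by rewrite (_ : shift i 0 = 0) ?K_0 //; apply/ffunP=> y; rewrite !ffunE.
Qed.

Lemma K_shiftE i f : (shift i f \in KG) = (f \in KG).
Proof.
apply/idP/idP => [|]; last exact: K_shift.
by move/(K_shift (- i)); rewrite shift_shift addNr shift0.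
Qed.

(* Since p is invertible modulo q, every Gam y is a combination of the products
   (1, Gam y) (1, Gam x)^(p-1) and of (1, Gam x)^p. *)
Lemma semidirect_ind (P : 'F_p -> fpq -> Prop) : p <> q ->
  P 0 0 -> (forall i f j h, P i f -> P j h -> P (j + i) (h + shift j f)) ->
  (forall x, P 1 (Gm x)) -> forall i f, f \in KG -> P i f.
Proof.
move=> neq_pq P0 PC PG.
(* [pw x k] is the function part of the k-th power of [(1, Gam x)]. For k = p it is the sum [S] of
   all the [Gam y], whatever [x] is. *)
pose S : fpq := \sum_x Gm x.
pose pw x k : fpq := \sum_(j < k) shift j%:R (Gm x).
have pwP x k : P k%:R (pw x k).
  elim: k => [|k IH]; first by rewrite /pw big_ord0.
  by have := PC _ _ _ _ (PG x) IH; rewrite natr1 /pw big_ord_recr.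
have pwSl x k : pw x k.+1 = Gm x + shift 1 (pw x k).
  rewrite /pw big_ord_recl shift0; congr (_ + _).
  rewrite (big_morph (shift 1) (shiftD 1) (id1 := 0)); last first.
    by apply/ffunP=> z; rewrite !ffunE.
  by apply: eq_bigr => j _; rewrite shift_shift nat1r.
have p0 : p%:R = 0 :> 'F_p by apply/eqP; rewrite Fp_natr_eq0.
have pwS x : pw x p = S.
  rewrite (congr1 (pw x) (esym (Fp_cast p_prime))) /pw /S.
  rewrite [RHS](reindex_inj (addrI x)) [RHS](reindex_inj oppr_inj) /=.
  by apply: eq_bigr => j _; rewrite shift_Gam natr_Zp.
have PS : P 0 S by rewrite -(pwS 0) -p0.
have P0D f h : P 0 f -> P 0 h -> P 0 (f + h).
  by move=> Pf Ph; have := PC _ _ _ _ Ph Pf; rewrite addr0 shift0.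
have P0M f n : P 0 f -> P 0 (f *+ n).
  by move=> Pf; elim: n => // n IH; rewrite mulrS; apply: P0D.
have P0S f a : P 0 f -> P 0 (scale a f).
  by move=> Pf; rewrite scale_natmul; apply: P0M.
have PD x y : P 0 (Gm y + S - Gm x).
  have pE : p = p.-1.+1 by rewrite prednK ?prime_gt0.
  have -> : Gm y + S - Gm x = Gm y + shift 1 (pw x p.-1).
    by rewrite -(pwS x) (congr1 (pw x) pE) pwSl addrAC -!addrA addKr.
  have := PC _ _ _ _ (pwP x p.-1) (PG y).
  by rewrite nat1r -pE p0.
have PGam y : P 0 (Gm y).
  have pq0 : p%:R != 0 :> 'F_q.
    by rewrite Fp_natr_eq0 // dvdn_prime2 // eq_sym; apply/eqP.
  (* The sum over [x] is p [Gm y] + (p - 1) [S], whence the correction (1 - p) [S] before dividing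
     by p. *)
  have E : Gm y =
      scale (p%:R^-1) (\sum_x (Gm y + S - Gm x) + scale (1 - p%:R) S).
    have -> : \sum_x (Gm y + S - Gm x) + scale (1 - p%:R) S = Gm y *+ p.
      rewrite big_split sumr_const card_Fp //= sumrN -/S.
      apply/ffunP=> z; rewrite !ffunE !ffunMnE !ffunE mulrBl mul1r mulr_natl.
      by rewrite mulrnDl addrA subrK addrK.
    apply/ffunP=> z; rewrite !ffunE ffunMnE ffunE.
    by rewrite -[Gam0 _ *+ p]mulr_natl mulKf.
  rewrite E; apply: (P0S); apply: (P0D); last exact: P0S.
  by apply: (big_ind (P 0)) => // x _; apply: PD.
have PK f : f \in KG -> P 0 f.
  by elim/K_ind=> // f' x IH; apply: P0D.
have P1 : P 1 0.
  have := PC _ _ _ _ (PG 0) (PK _ (KN (K_Gam 0))).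
  by rewrite shift0 add0r addNr.
have Pi i : P i 0.
  rewrite -[i]natr_Zp; elim: (i : nat) => // n IH.
  have := PC _ _ _ _ P1 IH; rewrite natr1 add0r.
  by congr (P _); apply/ffunP=> z; rewrite !ffunE.
move=> i f /PK Pf; have := PC _ _ _ _ (Pi i) Pf.
rewrite add0r shift0; congr P; exact: addr0.
Qed.

End Cocycles.

(** * Values of functions in K at one and two points *)

Section Evaluation.

Variables p q : nat.
Hypotheses (p_prime : prime p) (q_prime : prime q).
Variables (Gam0 : 'F_p -> 'F_q) (x0 : 'F_p).
Hypothesis Gam0_nprop : ~ proportional_to_character Gam0.
Hypothesis Gam0_x0 : Gam0 (- x0) = 1.

Local Notation fpq := {ffun 'F_p -> 'F_q}.
Local Notation Gm := (Gam Gam0).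
Local Notation KG := (K Gam0).

Lemma Gam_x0_0 : Gm x0 0 = 1.
Proof. by rewrite ffunE sub0r. Qed.

Lemma K_eval1 (x : 'F_p) (a : 'F_q) : exists2 f, f \in KG & f x = a.
Proof.
exists (scale a (shift (- x) (Gm x0))).
  by rewrite K_scale // K_shift // K_Gam.
by rewrite ffunE shiftE subrr Gam_x0_0 mulr1.
Qed.

(* Otherwise f (z + d) = l * f z for all f in K, where d = y - x, which makes
   Gam0 proportional to the character z |-> l ^ (z / d). *)
Lemma K_separates (x y : 'F_p) :
  x != y -> exists f, [/\ f \in KG, f x = 0 & f y != 0].
Proof.
move=> nxy; have [f /and3P[fK /eqP fx fy]|noF] :=
  pickP [pred f : fpq | [&& f \in KG, f x == 0 & f y != 0]]; first by exists f.
have kerE f : f \in KG -> f x = 0 -> f y = 0.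
  move=> fK fx; have := noF f; rewrite /= fK fx eqxx /=.
  by move/negbFE/eqP.
have [ex exK exx] := K_eval1 x 1.
pose d := y - x; pose l := ex y.
have d0 : d != 0 by rewrite subr_eq0 eq_sym.
have fl f : f \in KG -> f y = l * f x.
  move=> fK; have : (f - scale (f x) ex) y = 0.
    apply: kerE; first by rewrite KD // KN // K_scale.
    by rewrite !ffunE exx mulr1 subrr.
  by rewrite !ffunE => /eqP; rewrite subr_eq0 mulrC => /eqP.
have Gl z : Gam0 (z + d) = l * Gam0 z.
  have := fl _ (K_Gam Gam0 (x - z)); rewrite !ffunE.
  by congr (Gam0 _ = _ * Gam0 _); rewrite /d; ring.
have Gln z n : Gam0 (z + d *+ n) = l ^+ n * Gam0 z.
  elim: n => [|n IH]; first by rewrite addr0 mul1r.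
  by rewrite mulrSr addrA Gl IH exprS mulrA.
have zd z : d *+ (z / d)%R = z by rewrite -mulr_natl natr_Zp divfK.
(* Since [- x0] is a multiple of [d], the value 1 of [Gam0] there is a power of [l] times
   [Gam0 0]. *)
have G00 : Gam0 0 != 0.
  apply/eqP => G00; have := Gln 0 (- x0 / d)%R.
  by rewrite zd add0r Gam0_x0 G00 mulr0 => /eqP; rewrite oner_eq0.
have l0 : l != 0.
  by apply: contraNneq G00 => l0; have := Gl (- d);
    rewrite addNr l0 mul0r => ->.
case: Gam0_nprop; exists (Gam0 0), (fun z => l ^+ (z / d)%R); split=> //.
- by move=> z; rewrite expf_neq0.
- move=> z t; apply: (mulIf G00); rewrite -exprD -!Gln !add0r zd.
  by rewrite mulrnDr !zd.
- by move=> z; rewrite mulrC -Gln add0r zd.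
Qed.

Lemma K_eval2 (x y : 'F_p) (a b : 'F_q) : x != y ->
  exists f, [/\ f \in KG, f x = a & f y = b].
Proof.
move=> nxy; have [f [fK fx fy]] := K_separates nxy.
have [g [gK gy gx]] : exists g, [/\ g \in KG, g y = 0 & g x != 0].
  by apply: K_separates; rewrite eq_sym.
exists (scale (b / f y) f + scale (a / g x) g); split.
- by rewrite KD ?K_scale.
  by rewrite !ffunE fx mulr0 add0r divfK.
by rewrite !ffunE gy mulr0 addr0 divfK.
Qed.

(** Y is a bundle over 'F_p on whose fibres the maps act by translations. An invariant section [h]
    would give [Gm x z = h (z + 1) - h z] for all [x], so [Gam0] would be constant and [f 1 = f 0]
    on K, against [K_eval2]. *)
Lemma translate_transitive : transitive_family (fun x => translate 1 (Gm x)).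
Proof.
have tr1 : transitive_family (fun (_ : 'F_p) (z : 'F_p) => z + 1).
  move=> A invA; have [->|/set0Pn[z zA]] := eqVneq A set0; first by left.
  have zn n : z + n%:R \in A.
    elim: n => [|n IH]; first by rewrite addr0.
    by rewrite -natr1 addrA (invA 0).
  right; apply/setP=> t; rewrite inE -(subrK z t) addrC -[t - z]natr_Zp.
  exact: zn.
have := @transitive_affine_bundle _ _ q (fun _ z => z + 1) (fun _ _ => 1)
  (fun x z => Gm x z) q_prime tr1 (fun _ _ => oner_neq0 _).
move=> H A invA; apply: H => [h hE|x w wA]; last first.
  by have := invA x w wA; rewrite /translate mul1r.
have [f [fK f0 f1]] := K_eval2 0 1 (oner_neq0 'F_p).
suff : f 1 = f 0 by rewrite f0 f1 => /eqP; rewrite eq_sym oner_eq0.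
have hG x z : Gm x z = h (z + 1) - h z by rewrite (hE x) mul1r addrC addKr.
move: f fK {f0 f1}; apply: K_ind => [|f x IH]; first by rewrite !ffunE.
rewrite !ffunE IH; congr (_ + _).
have := hG (x - 1) 0; have := hG x 0; rewrite !ffunE => -> <-.
by congr Gam0; ring.
Qed.

End Evaluation.

(** * Equivariant functions and sufficiency *)

Section CharacterLaws.

Variables (p q r : nat) (xi : 'F_p -> 'F_r).
Hypotheses (q_prime : prime q) (xiR : xi_roots q xi).

Local Notation fpq := {ffun 'F_p -> 'F_q}.

Lemma expr_Fp (z : 'F_r) n : z ^+ q = 1 -> z ^+ (n%:R : 'F_q) = z ^+ n.
Proof. by move=> zq; rewrite /= val_Fp_nat // expr_mod. Qed.

Lemma expr_FpD (z : 'F_r) (a b : 'F_q) :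
  z ^+ q = 1 -> z ^+ (a + b)%R = z ^+ a * z ^+ b.
Proof.
move=> zq; rewrite -exprD -(expr_Fp (a + b)%N zq) natrD.
by rewrite !natr_Zp.
Qed.

Lemma chiD x (f g : fpq) : chi xi x (f + g) = chi xi x f * chi xi x g.
Proof.
rewrite /chi -big_split /=; apply: eq_bigr => y y0.
by rewrite ffunE expr_FpD //; case: (xiR y0).
Qed.

Lemma chi0f x : chi xi x (0 : fpq) = 1.
Proof. by rewrite /chi big1 // => y _; rewrite ffunE expr0. Qed.

Lemma chi_neq0 x (f : fpq) : chi xi x f != 0.
Proof.
rewrite /chi prodf_seq_neq0; apply/allP=> y _; apply/implyP=> y0.
by rewrite expf_neq0 //; case: (xiR y0).
Qed.

Lemma chiN x (f : fpq) : chi xi x (- f) = (chi xi x f)^-1.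
Proof.
apply: (mulIf (chi_neq0 x f)); rewrite -chiD addNr chi0f mulVf //.
exact: chi_neq0.
Qed.

End CharacterLaws.

Lemma chi_shift (p q r : nat) (xi : 'F_p -> 'F_r) x i
    (f : {ffun 'F_p -> 'F_q}) :
  chi xi x (shift i f) = chi xi (x + i) f.
Proof. by apply: eq_bigr => y _; rewrite shiftE addrA. Qed.

Lemma chi_1 (p q r : nat) x (f : {ffun 'F_p -> 'F_q}) :
  chi (fun _ => 1 : 'F_r) x f = 1.
Proof. by rewrite /chi big1 // => y _; rewrite expr1n. Qed.

Section Extension.

Variables p q r : nat.
Hypotheses (p_prime : prime p) (q_prime : prime q) (r_prime : prime r).
Variable Gam0 : 'F_p -> 'F_q.

Local Notation fpq := {ffun 'F_p -> 'F_q}.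
Local Notation Y := ('F_p * 'F_q)%type.
Local Notation Gm := (Gam Gam0).
Local Notation KG := (K Gam0).

(** Multiplication by [(j, h)] permutes the semidirect product of K and 'F_p. *)
Lemma sum_semidirect (F : 'F_p -> fpq -> 'F_r) j h : h \in KG ->
  \sum_i \sum_(f in KG) F (j + i) (h + shift j f)
  = \sum_i \sum_(f in KG) F i f.
Proof.
move=> hK; rewrite [RHS](reindex_inj (addrI j)) /=; apply: eq_bigr => i _.
rewrite [RHS](reindex (fun f => h + shift j f)) /=; last first.
  exists (fun f => shift (- j) (f - h)) => f _ /=.
    by rewrite addrC addKr shift_shift addNr shift0.
  by rewrite shift_shift subrr shift0 addrC subrK.
apply: eq_bigl => f; apply/idP/idP => [fK|]; first by rewrite KD // K_shift.
by move=> hf; rewrite -(K_shiftE Gam0 j) -(addKr h (shift j f)) KD // KN.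
Qed.

Lemma sum_K_shift (F : fpq -> 'F_r) j :
  \sum_(f in KG) F (shift j f) = \sum_(f in KG) F f.
Proof.
rewrite [RHS](reindex (shift j)) /=; last first.
  by exists (shift (- j)) => f _ /=; rewrite shift_shift ?subrr ?addNr shift0.
by apply: eq_bigl => f; rewrite K_shiftE.
Qed.

(** K is a subgroup of a q-group, so its order can be inverted modulo r when averaging. *)
Lemma K_card_neq0 : q <> r -> #|KG|%:R != 0 :> 'F_r.
Proof.
move=> neq_qr; rewrite Fp_natr_eq0 //; apply/negP => rK.
have : (r %| #|[set: fpq]|)%N by apply: dvdn_trans rK (cardSg (subsetT _)).
rewrite cardsT card_ffun !card_Fp // Euclid_dvdX // dvdn_prime2 //.
by case/andP=> /eqP/esym.
Qed.

Section Bundle.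

Variable xi : 'F_p -> 'F_r.
Hypothesis xiR : xi_roots q xi.

Definition bundle_op (Psi : Y -> Y -> 'F_r) (u v : Y * 'F_r) : Y * 'F_r :=
  (translate 1 (Gm u.1.1) v.1, chi xi v.1.1 (Gm u.1.1) * (v.2 + Psi u.1 v.1)).

Definition equivariant (Psi : Y -> Y -> 'F_r) : Prop :=
  forall i f u w, f \in KG ->
    Psi (translate i f u) (translate i f w) = chi xi w.1 f * Psi u w.

Lemma chi_Gam_translate x y i :
  chi xi (y + i) (Gm (x + i)) = chi xi y (Gm x).
Proof. by rewrite -chi_shift shift_Gam addrK. Qed.

Lemma bundle_op_inj Psi u : injective (bundle_op Psi u).
Proof.
move=> [v s] [w t] E; have vw : v = w := translate_inj (congr1 fst E).
move: (congr1 snd E); rewrite -vw /= => /(mulfI (chi_neq0 xiR _ _))/addIr -> //.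
Qed.

(** By equivariance both sides of the cycle identity have fibre coordinate equal to the product of
    the two multipliers at [w] with [t + Psi u w + Psi v w], which is symmetric in [u] and [v]. *)
Lemma bundle_op_cycle_set Psi :
  equivariant Psi -> is_cycle_set (bundle_op Psi).
Proof.
move=> eqv; split=> [[[x a] s] [[y b] t] [[z c] e]|u|].
- rewrite /bundle_op /=; congr (_, _).
    rewrite /translate /= !ffunE /=; congr (_, _).
    by rewrite -!addrA; congr (_ + _); rewrite addrC;
      congr (Gam0 _ + Gam0 _); ring.
  rewrite !chi_Gam_translate !eqv ?K_Gam //=; ring.
- exact: injF_bij (@bundle_op_inj Psi u).
- apply: injF_bij => -[[x a] s] [[y b] t] E.
  have xy : x = y := addIr 1 (congr1 (fun v => v.1.1) E).
  rewrite -{y}xy in E *; have := congr1 (fun v => v.1.2) E.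
  rewrite /= !ffunE => /addIr ab; rewrite -{b}ab in E *.
  by move: (congr1 snd E) => /= /(mulfI (chi_neq0 xiR _ _))/addIr ->.
Qed.

(* Averaging an invariant section over the group of all translate i f replaces
   its coboundary Psi by 0, but it does not change an equivariant Psi. *)
Lemma bundle_section_eq0 Psi (h : Y -> 'F_r) : p <> r -> q <> r ->
  equivariant Psi ->
  (forall u w, h (translate 1 (Gm u.1) w) =
     chi xi w.1 (Gm u.1) * (h w + Psi u w)) ->
  forall u w, Psi u w = 0.
Proof.
move=> neq_pr neq_qr eqv hE u w.
pose H w := \sum_i \sum_(f in KG) (chi xi w.1 f)^-1 * h (translate i f w).
have HE j k v : k \in KG -> H (translate j k v) = chi xi v.1 k * H v.
  move=> kK; rewrite /H -[in RHS](sum_semidirect _ j kK) mulr_sumr.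
  apply: eq_bigr => i _; rewrite mulr_sumr; apply: eq_bigr => f _.
  rewrite translate_comp /= -chi_shift chiD // mulrA; congr (_ * _).
  by rewrite invfM mulVKf // chi_neq0.
(* Read at the translates by [(i, f)], [hE] writes [Psi u w] as a difference of summands of [H].
   Summed over the group, the two resulting terms cancel by [HE]. *)
have PE i f : f \in KG -> Psi u w =
    (chi xi w.1 (Gm u.1))^-1 * ((chi xi (w.1 + 1) (shift (- 1) f))^-1 *
      h (translate i (shift (- 1) f) (translate 1 (Gm u.1) w)))
    - (chi xi w.1 f)^-1 * h (translate i f w).
  move=> fK; have := hE (translate i f u) (translate i f w).
  rewrite eqv // chi_Gam_translate !translate_comp.
  rewrite shift_shift subrr shift0 chi_shift addrK /=.
  rewrite shift_Gam addrK [i + 1]addrC [f + _]addrC => ->.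
  by field; rewrite !chi_neq0.
have : \sum_(i : 'F_p) \sum_(f in KG) Psi u w = 0.
  under eq_bigr => i _ do under eq_bigr => f fK do rewrite (PE i f fK).
  under eq_bigr => i _ do rewrite sumrB -mulr_sumr
    (sum_K_shift (fun f => (chi xi (w.1 + 1) f)^-1 *
       h (translate i f (translate 1 (Gm u.1) w)))).
  rewrite sumrB -mulr_sumr -/(H w) -[X in _ * X]/(H (translate 1 (Gm u.1) w)).
  by rewrite HE ?K_Gam // mulKf ?subrr // chi_neq0.
rewrite sumr_const sumr_const -mulrnA -mulr_natl => /eqP.
rewrite mulf_eq0 natrM mulf_eq0 (negPf (K_card_neq0 neq_qr)) /=.
rewrite card_Fp // Fp_natr_eq0 // dvdn_prime2 //.
by case/orP=> [/eqP/esym|/eqP].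
Qed.

Lemma bundle_op_indecomposable (x0 : 'F_p) Psi : p <> r -> q <> r ->
  ~ proportional_to_character Gam0 -> Gam0 (- x0) = 1 ->
  equivariant Psi -> (exists u w, Psi u w != 0) ->
  indecomposable (bundle_op Psi).
Proof.
move=> neq_pr neq_qr nprop G1 eqv [u0 [w0 Psi0]].
apply: transitive_indecomposable; first exact: bundle_op_inj.
have tr : transitive_family (fun u : Y => translate 1 (Gm u.1)).
  move=> A invA; apply: (translate_transitive q_prime nprop G1) => x w.
  exact: (invA (x, 0)).
have := transitive_affine_bundle (m := fun u w => chi xi w.1 (Gm u.1))
  (n := fun u w => chi xi w.1 (Gm u.1) * Psi u w) r_prime tr
  (fun u w => chi_neq0 xiR _ _).
move=> H A invA; apply: H => [h hE|u [w t] wA].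
  have Psi00 := bundle_section_eq0 neq_pr neq_qr eqv (h := h).
  by rewrite Psi00 ?eqxx in Psi0 => // u w; rewrite hE mulrDr.
by have := invA (u, 0) (w, t) wA; rewrite /bundle_op mulrDr.
Qed.

End Bundle.

End Extension.

Lemma is_cycle_set_ext (T : finType) (op op' : T -> T -> T) :
  op =2 op' -> is_cycle_set op -> is_cycle_set op'.
Proof.
move=> E [cyc bij sq]; split=> [x y z|x|].
- by rewrite -!E cyc.
- exact: eq_bij (bij x) _ (E x).
- by apply: eq_bij sq _ _ => x; apply: E.
Qed.

Lemma indecomposable_ext (T : finType) (op op' : T -> T -> T) :
  op =2 op' -> indecomposable op -> indecomposable op'.
Proof.
move=> E ind [A [B [AB [clA clB]]]]; apply: ind; exists A, B; split=> //.
by split=> x y xA yA; rewrite E; [apply: clA|apply: clB].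
Qed.

(** * The two normal forms as equivariant functions *)

Section Forms.

Variables p q r : nat.
Hypotheses (p_prime : prime p) (q_prime : prime q) (r_prime : prime r).
Variables (Gam0 : 'F_p -> 'F_q) (x0 : 'F_p).
Hypothesis Gam0_nprop : ~ proportional_to_character Gam0.
Hypothesis Gam0_x0 : Gam0 (- x0) = 1.

Local Notation fpq := {ffun 'F_p -> 'F_q}.
Local Notation Y := ('F_p * 'F_q)%type.
Local Notation Gm := (Gam Gam0).
Local Notation KG := (K Gam0).

Definition Psi1 (Phi1 : 'F_q -> 'F_r) (Phi2 : 'F_p -> 'F_r) (u w : Y) : 'F_r :=
  if u.1 == w.1 then Phi1 (w.2 - u.2) else Phi2 (u.1 - w.1).

(** [translate u.1 (scale u.2 (Gm x0))] carries [(0, 0)] to [u], as [Gm x0 0 = 1]. The formula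
    transports [Phi0], the value at the base point [(0, 0)], along this map. *)
Definition Psi2 (xi c : 'F_p -> 'F_r) (u w : Y) : 'F_r :=
  chi xi (w.1 - u.1) (scale u.2 (Gm x0))
  * Phi0 Gam0 xi c (w.1 - u.1) (w.2 - u.2 * Gm x0 (w.1 - u.1)).

Lemma op1_bundle Phi1 Phi2 :
  bundle_op Gam0 (fun=> 1) (Psi1 Phi1 Phi2) =2 op1 Gam0 Phi1 Phi2.
Proof.
move=> [[x a] s] [[y b] t]; rewrite /bundle_op /translate /Psi1 /= ffunE.
by rewrite chi_1 mul1r; case: ifP.
Qed.

Lemma op2_bundle xi c :
  bundle_op Gam0 xi (Psi2 xi c) =2 op2 Gam0 xi x0 c.
Proof.
by move=> [[x a] s] [[y b] t]; rewrite /bundle_op /translate /Psi2 /= ffunE.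
Qed.

Lemma xi_roots_1 : xi_roots q (fun _ : 'F_p => 1 : 'F_r).
Proof. by move=> y _; rewrite oner_neq0 expr1n. Qed.

Lemma Psi1_equivariant Phi1 Phi2 :
  equivariant Gam0 (fun=> 1 : 'F_r) (Psi1 Phi1 Phi2).
Proof.
move=> i f u w _; rewrite chi_1 mul1r /Psi1 /= (inj_eq (addIr i)).
case: eqP => [->|_]; first by congr Phi1; ring.
by congr Phi2; ring.
Qed.

Lemma Psi1_neq0 Phi1 Phi2 : cond1 Phi1 Phi2 ->
  exists u w, Psi1 Phi1 Phi2 u w != 0.
Proof.
move=> c1; have [b b0|P1] := pickP (fun b => Phi1 b != 0).
  by exists (0, 0), (0, b); rewrite /Psi1 eqxx subr0.
have [x /andP[x_0 x0']|P2] := pickP (fun x => (x != 0) && (Phi2 x != 0)).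
  by exists (x, 0), (0, 0); rewrite /Psi1 (negPf x_0) subr0.
case: c1; split=> [b|x xn]; first by apply/eqP/negbFE/P1.
by apply/eqP/negbFE; have := P2 x; rewrite xn.
Qed.

Lemma K0P f : reflect (f \in KG /\ f 0 = 0) (f \in K0 Gam0).
Proof. by rewrite inE; apply: (iffP andP) => -[-> /eqP]. Qed.

Lemma K0D f g : f \in K0 Gam0 -> g \in K0 Gam0 -> f + g \in K0 Gam0.
Proof.
move=> /K0P[fK f0] /K0P[gK g0]; apply/K0P; rewrite KD // ffunE f0 g0.
by rewrite addr0.
Qed.

Lemma K0N f : f \in K0 Gam0 -> - f \in K0 Gam0.
Proof. by move=> /K0P[fK f0]; apply/K0P; rewrite KN // ffunE f0 oppr0. Qed.

Lemma K0_0 : (0 : fpq) \in K0 Gam0.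
Proof. by apply/K0P; rewrite K_0 ffunE. Qed.

Section Second.

Variable xi : 'F_p -> 'F_r.
Hypothesis xiR : xi_roots q xi.

Lemma NchiP x :
  reflect (forall f, f \in K0 Gam0 -> f x = 0 -> chi xi x f = 1)
          (x \in Nchi Gam0 xi).
Proof.
rewrite inE; apply: (iffP forall_inP) => H f fK.
  by move=> /eqP fx; apply/eqP; have := H f fK; rewrite fx.
by apply/implyP=> /eqP fx; apply/eqP/H.
Qed.

(** Two functions in K0 that agree at [x] differ by one vanishing at [x], on which [chi xi x] is 1;
    so the choice made by [pick] does not matter. *)
Lemma phi0_eval x f : x \in Nchi Gam0 xi -> f \in K0 Gam0 ->
  phi0 Gam0 xi x x (f x) = chi xi x f.
Proof.
move=> /NchiP xN fK; rewrite /phi0 eqxx; case: pickP => [g /andP[gK /eqP gf]|].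
  have : chi xi x (g - f) = 1.
    by apply: xN; rewrite ?K0D ?K0N // !ffunE gf subrr.
  by rewrite chiD // chiN // => /divr1_eq.
by move/(_ f); rewrite /= fK eqxx.
Qed.

Lemma Phi0E c y a : Phi0 Gam0 xi c y a =
  if y \in Nchi Gam0 xi then c y * phi0 Gam0 xi y y a else 0.
Proof.
rewrite /Phi0 (bigID (pred1 y)) /= [X in _ + X]big1 ?addr0; last first.
  by move=> x /andP[_ xy]; rewrite /phi0 (negPf xy) mulr0.
case: ifP => yN.
  rewrite (big_pred1 y) // => x; rewrite /= andbC.
  by case: eqP => // ->.
by rewrite big_pred0 // => x; rewrite andbC; case: eqP => // ->.
Qed.

Lemma phi0_equivariant x a g : x \in Nchi Gam0 xi -> g \in K0 Gam0 ->
  phi0 Gam0 xi x x (a + g x) = chi xi x g * phi0 Gam0 xi x x a.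
Proof.
move=> xN gK; have [f /andP[fK /eqP <-]|noF] :=
  pickP [pred f : fpq | (f \in K0 Gam0) && (f x == a)].
  have -> : f x + g x = (f + g) x by rewrite ffunE.
  by rewrite !phi0_eval ?K0D // chiD // mulrC.
(* If no function in K0 takes the value [a] at [x], as for [x = 0] and [a] nonzero, then none takes
   [a + g x], and both sides are the default 0. *)
rewrite /phi0 eqxx; case: pickP => [f /andP[fK /eqP fx]|_].
  have := noF (f - g); rewrite /= K0D ?K0N // !ffunE fx addrK eqxx.
  by [].
by case: pickP => [f|_]; rewrite ?mulr0 //; have := noF f => /= ->.
Qed.

Lemma Psi2_equivariant c : equivariant Gam0 xi (Psi2 xi c).
Proof.
move=> i f [x a] [y b] fK; rewrite /Psi2 /translate /=.
have -> : y + i - (x + i) = y - x by ring.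
set d := y - x.
pose f' := shift x f.
(* Up to a multiple of [Gm x0], which only moves the base point, [f'] acts through its part [g] in
   K0. *)
pose g := f' - scale (f' 0) (Gm x0).
have f'0 : f' 0 = f x by rewrite shiftE add0r.
have f'd : f' d = f y by rewrite shiftE subrK.
have f'K : f' \in KG by rewrite K_shift.
have GK : Gm x0 \in KG by rewrite K_Gam.
have gK : g \in K0 Gam0.
  by apply/K0P; rewrite KD ?KN ?K_scale // !ffunE sub0r Gam0_x0 mulr1 subrr.
have scD : scale (a + f x) (Gm x0) = scale a (Gm x0) + (f' - g).
  by apply/ffunP=> z; rewrite !ffunE -f'0 !ffunE; ring.
have -> : b + f y - (a + f x) * Gm x0 d = b - a * Gm x0 d + g d.
  by rewrite -f'0 -f'd !ffunE; ring.
clearbody g; rewrite !Phi0E; case: ifP => dN; last by rewrite !mulr0.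
rewrite phi0_equivariant // scD !chiD // chiN //.
rewrite -[chi xi y f](_ : chi xi d f' = _).
  by field; rewrite chi_neq0.
by rewrite /f' chi_shift subrK.
Qed.

Lemma Psi2_neq0 c : (exists2 x, x \in Nchi Gam0 xi & c x != 0) ->
  exists u w, Psi2 xi c u w != 0.
Proof.
case=> x xN cx; exists (0, 0), (x, 0).
rewrite /Psi2 /= mul0r !subr0 Phi0E xN !mulf_neq0 ?chi_neq0 //.
have -> : 0 = (0 : fpq) x by rewrite ffunE.
by rewrite phi0_eval ?K0_0 // chi_neq0.
Qed.

(** Move [u] to [(0, 0)], so that only K0 still acts. For [d] in [Nchi], which excludes 0 as chi is
    nontrivial on K0, some [f] in K0 carries [(d, 0)] to [(d, b')]. For any other [d], some [f] in
    K0 fixes [(d, b')] with multiplier different from 1, so [Psi] vanishes there. *)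
Lemma equivariant_Psi2 Psi : equivariant Gam0 xi Psi ->
  (exists2 f, f \in K0 Gam0 & chi xi 0 f != 1) ->
  Psi =2 Psi2 xi (fun d => Psi (0, 0) (d, 0)).
Proof.
move=> eqv [f1 f1K chi1] [x a] [y b].
rewrite /Psi2 /=; set d := y - x; set k := scale a _; set b' := b - _.
have kK : k \in KG by rewrite K_scale ?K_Gam.
have -> : (x, a) = translate x k (0, 0).
  by rewrite /translate /= !add0r !ffunE sub0r Gam0_x0 mulr1.
have -> : (y, b) = translate x k (d, b').
  by rewrite /translate /= subrK ffunE subrK.
rewrite eqv //=; congr (_ * _); rewrite Phi0E; case: ifP => dN.
  have [d0|d0] := eqVneq d 0.
    case/negP: chi1; apply/eqP; move: dN; rewrite d0 => /NchiP; apply=> //.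
    by case/K0P: f1K.
  have [f [fK fd f0]] := K_eval2 Gam0_nprop Gam0_x0 b' 0 d0.
  have fK0 : f \in K0 Gam0 by apply/K0P.
  rewrite -fd phi0_eval // mulrC -[RHS](eqv 0 f (0, 0) (d, 0)) // /translate /=.
  by rewrite !(addr0, add0r) f0.
have /forall_inPn[f fK] :
    ~~ [forall f in K0 Gam0, (f d == 0) ==> (chi xi d f == 1)].
  by move/negbT: dN; rewrite inE.
rewrite negb_imply => /andP[/eqP fd chif].
have [fKG f0] := K0P _ fK.
have := eqv 0 f (0, 0) (d, b') fKG; rewrite /translate /= f0 fd !addr0.
move/eqP; rewrite -subr_eq0 -{1}[Psi _ _]mul1r -mulrBl mulf_eq0 subr_eq0.
by rewrite eq_sym (negPf chif) => /eqP.
Qed.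

End Second.

(** [Psi] is constant on orbits of pairs. Over one point the invariant is the difference of second
    coordinates; over distinct points [K_eval2] cancels both second coordinates, leaving the
    difference of the first ones. *)
Lemma equivariant_Psi1 (Psi : Y -> Y -> 'F_r) :
  (forall i f u w, f \in KG ->
     Psi (translate i f u) (translate i f w) = Psi u w) ->
  Psi =2 Psi1 (fun b => Psi (0, 0) (0, b)) (fun x => Psi (x, 0) (0, 0)).
Proof.
move=> eqv [x a] [y b]; rewrite /Psi1 /=; case: eqVneq => [->|nxy].
  have [f fK f0] := K_eval1 Gam0_x0 0 a.
  rewrite -(eqv y f (0, 0)) // /translate /= f0 !add0r.
  congr (Psi _ (_, _)); ring.
have d0 : x - y != 0 by rewrite subr_eq0.
have [f [fK fd f0]] := K_eval2 Gam0_nprop Gam0_x0 a b d0.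
by rewrite -(eqv y f (x - y, 0)) // /translate /= f0 fd !add0r subrK.
Qed.

End Forms.

(** * Untwisting the multipliers *)

Section ExtendCharacter.

Variables p q r : nat.
Hypothesis q_prime : prime q.

Local Notation fpq := {ffun 'F_p -> 'F_q}.

Definition monomial (xi : 'F_p -> 'F_r) (f : fpq) : 'F_r :=
  \prod_y xi y ^+ nat_of_ord (f y).

Lemma monomialD xi f g : (forall y, xi y ^+ q = 1) ->
  monomial xi (f + g) = monomial xi f * monomial xi g.
Proof.
move=> xiq; rewrite -big_split; apply: eq_bigr => y _.
by rewrite ffunE expr_FpD.
Qed.

Lemma monomial_scale xi a f : (forall y, xi y ^+ q = 1) ->
  monomial xi (scale a f) = monomial xi f ^+ a.
Proof.
move=> xiq; rewrite scale_natmul; elim: (nat_of_ord a) => [|n IH].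
  by rewrite expr0 /monomial big1 // => y _; rewrite ffunE.
by rewrite mulrS exprS monomialD // IH.
Qed.

Variables (H : {set fpq}) (X : fpq -> 'F_r).
Hypothesis HD : forall f g, f \in H -> g \in H -> f + g \in H.
Hypothesis Hscale : forall a f, f \in H -> scale a f \in H.
Hypothesis XD : forall f g, f \in H -> g \in H -> X (f + g) = X f * X g.
Hypothesis X_neq0 : forall f, f \in H -> X f != 0.

Lemma char_natmul f n : f \in H -> f *+ n \in H /\ X (f *+ n) = X f ^+ n.
Proof.
move=> fH; have H0 : (0 : fpq) \in H.
  have -> : (0 : fpq) = scale 0 f by apply/ffunP=> y; rewrite !ffunE mul0r.
  exact: Hscale.
elim: n => [|n [IH IHX]]; last by rewrite mulrS exprS HD ?XD ?IHX.
split=> //; apply: (mulIf (X_neq0 H0)).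
by rewrite mul1r -XD // addr0.
Qed.

Lemma char_root f : f \in H -> X f ^+ q = 1.
Proof.
move=> fH; have [_ <-] := char_natmul q fH; have [_] := char_natmul 0 fH.
rewrite expr0 => <-; congr X; apply/ffunP=> y.
rewrite ffunMnE -mulr_natl (_ : q%:R = 0) ?mul0r ?ffunE //.
by apply/eqP; rewrite Fp_natr_eq0.
Qed.

(** Induction on a list of coordinates that supports the functions. A new coordinate [y] is either
    zero on all of them, or some [f2] has value 1 there; then each [f] is a multiple of [f2] plus a
    function supported on the old list. *)
Lemma extend_character : (exists f, f \in H) ->
  exists2 xi, (forall y, xi y != 0 /\ xi y ^+ q = 1) &
    forall f, f \in H -> X f = monomial xi f.
Proof.
case=> h hH.
suff [xi xiR xiE] : exists2 xi, (forall y, xi y != 0 /\ xi y ^+ q = 1) &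
    forall f, f \in H -> (forall y, y \notin enum 'F_p -> f y = 0) ->
    X f = monomial xi f.
  by exists xi => // f fH; apply: xiE => // y; rewrite mem_enum.
elim: (enum 'F_p) => [|y s [xi xiR xiE]].
  exists (fun=> 1) => [y|f fH f0]; first by rewrite oner_neq0 expr1n.
  rewrite /monomial big1 => [|y _]; last by rewrite expr1n.
  rewrite -(expr0 (X h)); have [_ <-] := char_natmul 0 hH.
  by congr X; apply/ffunP=> y; rewrite f0 // ffunE.
have [f1 /and3P[f1H /forallP f1s f1y]|noF] :=
  pickP [pred f : fpq | [&& f \in H,
    [forall z, (z \notin y :: s) ==> (f z == 0)] & f y != 0]]; last first.
  exists xi => // f fH fs; apply: xiE => // z zs.
  have [->|zy] := eqVneq z y; last by apply: fs; rewrite inE negb_or zy.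
  have := noF f; rewrite /= fH /= => /negbT; rewrite negb_and negbK.
  case/orP=> [/forallPn[t]|/eqP//]; rewrite negb_imply => /andP[ts].
  by rewrite fs ?eqxx.
pose f2 := scale (f1 y)^-1 f1.
have f2H : f2 \in H by apply: Hscale.
have f2y : f2 y = 1 by rewrite ffunE mulVf.
have f2s z : z \notin y :: s -> f2 z = 0.
  by move=> zs; have := f1s z; rewrite zs => /eqP f10; rewrite ffunE f10 mulr0.
clearbody f2.
(* The value at [y] that is forced by [X f2 = monomial xi' f2]. *)
pose z0 := X f2 / \prod_(z | z != y) xi z ^+ nat_of_ord (f2 z).
have P0 : \prod_(z | z != y) xi z ^+ nat_of_ord (f2 z) != 0.
  rewrite prodf_seq_neq0; apply/allP=> z _.
  by rewrite expf_neq0 ?implybT //; case: (xiR z).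
pose xi' z := if z == y then z0 else xi z.
have xi'R z : xi' z != 0 /\ xi' z ^+ q = 1.
  rewrite /xi'; case: ifP => // _; split.
    by rewrite mulf_neq0 ?invr_neq0 ?X_neq0.
  rewrite expr_div_n char_root // -prodrXl big1 ?divr1 // => t _.
  by rewrite exprAC; case: (xiR t) => _ ->; rewrite expr1n.
have xi'q z : xi' z ^+ q = 1 by case: (xi'R z).
exists xi' => // f fH fs.
pose f3 := f + scale (- f y) f2.
have f3H : f3 \in H by rewrite HD ?Hscale.
have f3y : f3 y = 0 by rewrite !ffunE f2y mulr1 subrr.
have f3s z : z \notin s -> f3 z = 0.
  have [->//|zy zs] := eqVneq z y; rewrite !ffunE.
  have zys : z \notin y :: s by rewrite inE negb_or zy.
  by rewrite (fs z zys) (f2s z zys) mulr0 addr0.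
have fE : f = f3 + scale (f y) f2.
  by apply/ffunP=> z; rewrite !ffunE mulNr subrK.
clearbody f3.
have X2 : X f2 = monomial xi' f2.
  rewrite /monomial (bigD1 y) //= f2y /xi' eqxx expr1.
  rewrite [X in _ * X](eq_bigr (fun z => xi z ^+ nat_of_ord (f2 z))).
    by rewrite divfK.
  by move=> z /negPf ->.
have X3 : X f3 = monomial xi' f3.
  rewrite xiE //; apply: eq_bigr => z _; rewrite /xi'.
  by case: eqP => // ->; rewrite f3y !expr0.
have scE : X (scale (f y) f2) = monomial xi' (scale (f y) f2).
  by rewrite monomial_scale // -X2 scale_natmul; case: (char_natmul (f y) f2H).
by rewrite fE XD ?Hscale // monomialD // X3 scE.
Qed.

End ExtendCharacter.

(** * Normalizing multipliers and cocycles *)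

Section Normalization.

Variables p q r : nat.
Hypotheses (p_prime : prime p) (q_prime : prime q) (r_prime : prime r).
Variables (Gam0 : 'F_p -> 'F_q) (x0 : 'F_p).
Hypothesis Gam0_x0 : Gam0 (- x0) = 1.
Hypotheses (neq_pq : p <> q) (neq_pr : p <> r) (neq_qr : q <> r).

Local Notation fpq := {ffun 'F_p -> 'F_q}.
Local Notation Y := ('F_p * 'F_q)%type.
Local Notation Gm := (Gam Gam0).
Local Notation KG := (K Gam0).

(** The coordinate 0 is absent from [chi xi 0], but functions in K0 vanish there. A trivial [X] is
    extended by [xi = 1], which makes chi trivial on all of K, as the first form needs. *)
Lemma extend_K0_character (X : fpq -> 'F_r) :
  (forall f g, f \in K0 Gam0 -> g \in K0 Gam0 -> X (f + g) = X f * X g) ->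
  (forall f, f \in K0 Gam0 -> X f != 0) ->
  exists xi : 'F_p -> 'F_r, [/\ xi_roots q xi,
    forall f, f \in K0 Gam0 -> chi xi 0 f = X f &
    (forall f, f \in K0 Gam0 -> chi xi 0 f = 1) -> xi = fun=> 1].
Proof.
move=> XD X0; have [/forall_inP X1|/forall_inPn[f fK Xf]] :=
    boolP [forall f in K0 Gam0, X f == 1].
  exists (fun=> 1); split=> //; first exact: xi_roots_1.
  by move=> f fK; rewrite chi_1; apply/esym/eqP/X1.
have K0_scale a g : g \in K0 Gam0 -> scale a g \in K0 Gam0.
  by move=> /K0P[gK g0]; apply/K0P; rewrite K_scale // ffunE g0 mulr0.
have [||xi xiR xiE] := extend_character q_prime _ K0_scale XD X0.
- exact: K0D.
- by exists f.
have chiE g : g \in K0 Gam0 -> chi xi 0 g = X g.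
  move=> gK; have /K0P[_ g0] := gK; rewrite xiE // /monomial (bigD1 0) //=.
  by rewrite g0 expr0 mul1r; apply: eq_bigr => y _; rewrite addr0.
exists xi; split=> // chi1; case/eqP: Xf.
by rewrite -chiE // chi1.
Qed.

(* The multiplier mu w of (i, f) at w is determined by Psi, hence a cocycle of
   the group generated by the maps translate 1 (Gam x). Restricted to the
   stabilizer K0 of (0, 0) it is a character, and transporting the fibre over
   (0, 0) along the maps translate y (b Gam x0) turns it into chi. *)
Lemma multiplier_character (Psi : Y -> Y -> 'F_r) :
  (forall w, exists u, Psi u w != 0) ->
  (forall i f, f \in KG -> exists mu : Y -> 'F_r, forall u w,
     Psi (translate i f u) (translate i f w) = mu w * Psi u w) ->
  exists (xi : 'F_p -> 'F_r) (g : Y -> 'F_r),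
    [/\ xi_roots q xi, forall w, g w != 0,
      (forall f, f \in K0 Gam0 -> chi xi 0 f = 1) -> xi = fun=> 1 &
      equivariant Gam0 xi (fun u w => Psi u w / g w)].
Proof.
move=> /fin_all_exists[nv nvP] twist.
pose mu i f w := Psi (translate i f (nv w)) (translate i f w) / Psi (nv w) w.
have muE i f u w : f \in KG ->
    Psi (translate i f u) (translate i f w) = mu i f w * Psi u w.
  by move=> /(twist i)[m mE]; rewrite /mu !mE mulfK.
have mu_neq0 i f w : f \in KG -> mu i f w != 0.
  move=> fK; apply: contraNneq (nvP (translate i f w)) => mu0.
  by rewrite -(translateVK i f (nv _)) muE // mu0 mul0r.
have muM i f j h w : f \in KG -> h \in KG ->
    mu (j + i) (h + shift j f) w = mu i f (translate j h w) * mu j h w.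
  move=> fK hK; apply: (mulIf (nvP w)).
  by rewrite -muE ?KD ?K_shift // -!translate_comp !muE // mulrA.
have GK : Gm x0 \in KG by apply: K_Gam.
have fix0 f : f \in K0 Gam0 -> translate 0 f (0, 0) = (0, 0).
  by move=> /K0P[_ f0]; rewrite /translate /= f0 !addr0.
have [||xi [xiR chiE xi1]] := @extend_K0_character (fun f => mu 0 f (0, 0)).
- move=> f g fK0 gK0; have [[fK _] [gK _]] := (K0P _ _ fK0, K0P _ _ gK0).
  by have := muM 0 g 0 f (0, 0) gK fK; rewrite addr0 shift0 fix0 // mulrC.
- by move=> f /K0P[fK _]; apply: mu_neq0.
pose e b := scale b (Gm x0).
have eK b : e b \in KG by apply: K_scale.
have e0 b : e b 0 = b by rewrite ffunE (Gam_x0_0 Gam0_x0) mulr1.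
(* [g w] compares the multiplier of the transport from [(0, 0)] to [w] with its chi-value. *)
pose g (w : Y) := mu w.1 (e w.2) (0, 0) / chi xi 0 (e w.2).
have g0 w : g w != 0 by rewrite mulf_neq0 ?invr_neq0 ?mu_neq0 ?chi_neq0.
exists xi, g; split=> // i f u w fK.
have toE v : translate v.1 (e v.2) (0, 0) = v.
  by case: v => y b; rewrite /translate /= e0 !add0r.
have muEg : mu i f w = chi xi w.1 f * g (translate i f w) / g w.
  pose v := translate i f w.
  (* Going from [(0, 0)] to [w], applying [(i, f)] and returning from [v] is an element [(0, k)]
     fixing [(0, 0)], where [mu] is chi. *)
  pose k := e w.2 + shift w.1 f - e v.2.
  have kK0 : k \in K0 Gam0.
    apply/K0P; rewrite KD ?KN ?KD ?K_shift //; split=> //.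
    have -> : k 0 = e w.2 0 + f w.1 - e v.2 0.
      by rewrite [k 0]ffunE [X in X + _]ffunE shiftE add0r [(- _ : fpq) 0]ffunE.
    by rewrite !e0 subrr.
  have kK : k \in KG by case/K0P: kK0.
  have E1 := muM i f w.1 (e w.2) (0, 0) fK (eK _).
  have E2 := muM v.1 (e v.2) 0 k (0, 0) (eK _) kK.
  have E3 : mu i f w * mu w.1 (e w.2) (0, 0) =
      mu v.1 (e v.2) (0, 0) * chi xi 0 k.
    rewrite chiE // -[X in mu i f X]toE -E1 -[X in mu v.1 _ X](fix0 k) // -E2.
    by rewrite add0r shift0 /k [e w.2 + _ - _ + _]subrK.
  rewrite -/v /g; apply: (mulIf (mu_neq0 w.1 (e w.2) (0, 0) (eK _))).
  rewrite E3 /k !(chiD, chiN) // chi_shift add0r; field.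
  by rewrite !chi_neq0 // mu_neq0.
by rewrite muE // muEg; field; rewrite !g0.
Qed.

(** The average of the twisted translates of [N] over the group is equivariant. It differs from [N]
    by a coboundary because this holds for each translate: the cocycle identity gives it for the
    generators [(1, Gam x)], and it passes to products. *)
Lemma coboundary_decomposition (xi : 'F_p -> 'F_r) (N : Y -> Y -> 'F_r) :
  xi_roots q xi ->
  (forall u v w,
    N u w + (chi xi w.1 (Gm u.1))^-1
            * N (translate 1 (Gm u.1) v) (translate 1 (Gm u.1) w)
    = N v w + (chi xi w.1 (Gm v.1))^-1
            * N (translate 1 (Gm v.1) u) (translate 1 (Gm v.1) w)) ->
  exists (H : Y -> 'F_r) (Psi : Y -> Y -> 'F_r), equivariant Gam0 xi Psi /\
    forall u w, N u w = Psi u w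
      - ((chi xi w.1 (Gm u.1))^-1 * H (translate 1 (Gm u.1) w) - H w).
Proof.
move=> xiR cyc.
pose T (i : 'F_p) f (v w : Y) :=
  (chi xi w.1 f)^-1 * N (translate i f v) (translate i f w).
pose dT (c : 'F_p -> Y -> 'F_r) j (v w : Y) :=
  (chi xi w.1 (Gm v.1))^-1 * c (j + 1) (translate 1 (Gm v.1) w) - c j w.
(* The primitive [c] depends on [j] because for a generator it involves [N] at first argument
   [(x + j, a)], and acting by [v] raises the first coordinate by 1. Summing over [j] finally
   removes this dependence. *)
pose P i f := exists c : 'F_p -> Y -> 'F_r, forall j v w,
  T i (shift (- j) f) v w - N v w = dT c j v w.
have q0 : q%:R != 0 :> 'F_r.
  by rewrite Fp_natr_eq0 // dvdn_prime2 // eq_sym; apply/eqP.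
have p0 : p%:R != 0 :> 'F_r.
  by rewrite Fp_natr_eq0 // dvdn_prime2 // eq_sym; apply/eqP.
have PK : forall i f, f \in KG -> P i f.
  apply: semidirect_ind => //.
  - exists (fun _ _ => 0) => j v w; rewrite /T /dT mulr0 subrr.
    have -> : shift (- j) 0 = 0 :> fpq by apply/ffunP=> y; rewrite !ffunE.
    have t0 t : translate 0 0 t = t :> Y.
      by case: t => y b; rewrite /translate /= ffunE !addr0.
    by rewrite !t0 chi0f invr1 mul1r subrr.
  - move=> i f k h [cf cfE] [ch chE].
    exists (fun j w => ch j w
      + (chi xi w.1 (shift (- j) h))^-1 * cf j (translate k (shift (- j) h) w)).
    move=> j v w; set hj := shift (- j) h.
    have E1 := cfE j (translate k hj v) (translate k hj w).
    have E2 : (chi xi w.1 hj)^-1 * N (translate k hj v) (translate k hj w)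
        = dT ch j v w + N v w by rewrite -chE subrK.
    rewrite shiftD shift_shift [- j + k]addrC -shift_shift -/hj.
    set fj := shift (- j) f.
    have -> : T (k + i) (hj + shift k fj) v w =
        (chi xi w.1 hj)^-1 * T i fj (translate k hj v) (translate k hj w).
      by rewrite /T !translate_comp chiD // chi_shift invfM mulrA.
    rewrite -[T i fj _ _](subrK (N (translate k hj v) (translate k hj w))).
    rewrite E1 mulrDr E2 /dT /= chi_Gam_translate !translate_comp.
    have -> : shift k (Gm (v.1 + k)) = Gm v.1 by rewrite shift_Gam addrK.
    have -> : shift 1 (shift (- (j + 1)) h) = hj.
      by rewrite shift_shift /hj; congr (shift _ _); ring.
    have -> : chi xi (w.1 + 1) (shift (- (j + 1)) h) = chi xi w.1 hj.
      by rewrite !chi_shift; congr (chi _ _ _); ring.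
    by rewrite [hj + _]addrC [k + 1]addrC; ring.
  - move=> x.
    (* In the cocycle identity at [(z, a)], acting by [v] also changes [a]; averaging over [a]
       absorbs this. *)
    exists (fun j w => q%:R^-1 * \sum_a N (x + j, a) w) => j v w.
    rewrite shift_Gam opprK; set z := x + j.
    have E a : T 1 (Gm z) v w - N v w = (chi xi w.1 (Gm v.1))^-1
          * N (z + 1, a + Gm v.1 z) (translate 1 (Gm v.1) w) - N (z, a) w.
      apply: (addrI (N (z, a) w)); have /= C := cyc (z, a) v w.
      by rewrite addrA /T C; ring.
    rewrite /dT; apply: (mulfI q0).
    transitivity (\sum_(a : 'F_q) (T 1 (Gm z) v w - N v w)).
      by rewrite sumr_const card_Fp // mulr_natl.
    rewrite (eq_bigr _ (fun a _ => E a)).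
    rewrite sumrB -mulr_sumr mulrBr [q%:R * (_ * _)]mulrCA !mulVKf //.
    rewrite addrA; congr (_ * _ - _).
    by rewrite [RHS](reindex_inj (addIr (Gm v.1 z))).
pose Pc i f := fun c : {ffun 'F_p * Y -> 'F_r} => f \in KG ->
    forall j v w,
      T i (shift (- j) f) v w - N v w = dT (fun j w => c (j, w)) j v w.
have /fin_all_exists[c cE] (g : 'F_p * fpq) : exists c, Pc g.1 g.2 c.
  have [gK|gK] := boolP (g.2 \in KG); last by exists 0 => /(negP gK).
  have [c cE] := PK g.1 _ gK; exists [ffun jw => c jw.1 jw.2] => _ j v w.
  by rewrite cE /dT !ffunE.
(* [M] counts the triples [(j, i, f)] in the average. *)
pose M : 'F_r := p%:R * (p%:R * #|KG|%:R).
have M0 : M != 0 by rewrite !mulf_neq0 ?K_card_neq0.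
pose A v w := \sum_i \sum_(f in KG) T i f v w.
pose H w := \sum_i \sum_(f in KG) \sum_j c (i, f) (j, w).
exists (fun w => H w / M), (fun v w => p%:R * A v w / M); split.
  move=> j k v w kK; rewrite mulrA; congr (_ / M).
  rewrite mulrCA; congr (_ * _).
  rewrite /A -[in RHS](sum_semidirect _ j kK) mulr_sumr.
  apply: eq_bigr => i _; rewrite mulr_sumr; apply: eq_bigr => f _.
  rewrite /T !translate_comp /= -chi_shift chiD // mulrA; congr (_ * _).
  by rewrite invfM mulVKf // chi_neq0.
move=> v w.
have : \sum_j \sum_i \sum_(f in KG) (T i (shift (- j) f) v w - N v w) =
    (chi xi w.1 (Gm v.1))^-1 * H (translate 1 (Gm v.1) w) - H w.
  rewrite exchange_big /=; under eq_bigr => i _ do rewrite exchange_big /=.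
  rewrite mulr_sumr -sumrB; apply: eq_bigr => i _.
  rewrite mulr_sumr -sumrB; apply: eq_bigr => f fK.
  rewrite mulr_sumr (eq_bigr (fun j => dT (fun j w => c (i, f) (j, w)) j v w)).
    rewrite sumrB -!mulr_sumr; congr (_ * _ - _).
    by rewrite [RHS](reindex_inj (addIr 1)).
  by move=> j _; apply: (cE (i, f)).
have -> : \sum_j \sum_i \sum_(f in KG) (T i (shift (- j) f) v w - N v w) =
    p%:R * A v w - M * N v w.
  transitivity (\sum_(j : 'F_p) (A v w - p%:R * (#|KG|%:R * N v w))).
    apply: eq_bigr => j _; transitivity
      (\sum_i (\sum_(f in KG) T i f v w - #|KG|%:R * N v w)).
      apply: eq_bigr => i _; rewrite sumrB (sum_K_shift _ (fun f => T i f v w)).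
      by rewrite sumr_const mulr_natl.
    by rewrite sumrB sumr_const card_Fp // -[_ *+ p]mulr_natl.
  by rewrite sumr_const card_Fp // -[LHS]mulr_natl mulrBr /M !mulrA.
move=> E; apply: (mulfI M0).
have -> : M * N v w = p%:R * A v w - (p%:R * A v w - M * N v w) by ring.
by rewrite E; clearbody M; field; rewrite M0 chi_neq0.
Qed.

End Normalization.

(** * Classification of affine extensions *)

Section Classification.

Variables p q r : nat.
Hypotheses (p_prime : prime p) (q_prime : prime q) (r_prime : prime r).
Hypotheses (neq_pq : p <> q) (neq_pr : p <> r) (neq_qr : q <> r).
Variables (Gam0 : 'F_p -> 'F_q) (x0 : 'F_p).
Hypothesis Gam0_nprop : ~ proportional_to_character Gam0.
Hypothesis Gam0_x0 : Gam0 (- x0) = 1.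

Local Notation fpq := {ffun 'F_p -> 'F_q}.
Local Notation Y := ('F_p * 'F_q)%type.
Local Notation Gm := (Gam Gam0).
Local Notation KG := (K Gam0).

Lemma op_isomorphic_trans (T U V : Type) opT opU opV :
  @op_isomorphic T U opT opU -> @op_isomorphic U V opU opV ->
  @op_isomorphic T V opT opV.
Proof.
move=> [f [fB fM]] [g [gB gM]]; exists (g \o f); split; first exact: bij_comp.
by move=> x y; rewrite /= fM gM.
Qed.

Lemma op_isomorphic_ext (T : Type) (op op' : T -> T -> T) :
  op =2 op' -> op_isomorphic op op'.
Proof. by move=> E; exists id; split=> //; exists id. Qed.

Lemma bundle_classification xi Psi : xi_roots q xi ->
  ((forall f, f \in K0 Gam0 -> chi xi 0 f = 1) -> xi = fun=> 1 :> 'F_r) ->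
  equivariant Gam0 xi Psi ->
  (exists x a b w, Psi (x, a) w != Psi (x, b) w) ->
  (exists (Phi1 : 'F_q -> 'F_r) (Phi2 : 'F_p -> 'F_r),
      cond1 Phi1 Phi2 /\
      op_isomorphic (bundle_op Gam0 xi Psi) (op1 Gam0 Phi1 Phi2)) \/
  (exists xi' c : 'F_p -> 'F_r,
      cond2 Gam0 xi' c /\
      op_isomorphic (bundle_op Gam0 xi Psi) (op2 Gam0 xi' x0 c)).
Proof.
move=> xiR xi1 eqv [x [a [b [w nPsi]]]].
have extP Psi' : Psi =2 Psi' ->
    op_isomorphic (bundle_op Gam0 xi Psi) (bundle_op Gam0 xi Psi').
  by move=> E; apply: op_isomorphic_ext => u v; rewrite /bundle_op E.
have [/forall_inP chi1|/forall_inPn[f fK chif]] :=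
    boolP [forall f in K0 Gam0, chi xi 0 f == 1].
  have xiE : xi = fun=> 1 by apply: xi1 => f fK; apply/eqP/chi1.
  rewrite {}xiE in eqv extP *.
  have eqv1 i f u v : f \in KG ->
      Psi (translate i f u) (translate i f v) = Psi u v.
    by move=> fK; rewrite eqv // chi_1 mul1r.
  have E := equivariant_Psi1 Gam0_nprop Gam0_x0 eqv1.
  left; eexists; eexists; split; last first.
    apply: op_isomorphic_trans (extP _ E) _.
    exact: op_isomorphic_ext (op1_bundle _ _ _).
  move=> [P1 P2]; case/eqP: nPsi; rewrite !E /Psi1 /=.
  by case: eqVneq => [_|xw]; rewrite ?P1 // !P2 // subr_eq0.
have E : Psi =2 Psi2 Gam0 x0 xi (fun d => Psi (0, 0) (d, 0)).
  by apply: equivariant_Psi2 => //; exists f.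
right; exists xi, (fun d => Psi (0, 0) (d, 0)); split; last first.
  apply: op_isomorphic_trans (extP _ E) _.
  exact: op_isomorphic_ext (op2_bundle _ _ _ _).
split=> //; first by exists f.
apply/exists_inP; apply: contraT => /exists_inPn c0.
case/eqP: nPsi; rewrite !E /Psi2 /Phi0 !big1 ?mulr0 //.
  by move=> z zN; move/negPn/eqP: (c0 z zN) => ->; rewrite mul0r.
by move=> z zN; move/negPn/eqP: (c0 z zN) => ->; rewrite mul0r.
Qed.

Definition affine_op (m : 'F_p -> Y -> 'F_r) (n : Y -> Y -> 'F_r)
    (u v : Y * 'F_r) : Y * 'F_r :=
  (translate 1 (Gm u.1.1) v.1, m u.1.1 v.1 * (v.2 + n u.1 v.1)).

Section Affine.

Variables (m : 'F_p -> Y -> 'F_r) (n : Y -> Y -> 'F_r).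
Hypothesis m_neq0 : forall x w, m x w != 0.
Hypothesis cyc : forall u v w : Y * 'F_r,
  affine_op m n (affine_op m n u v) (affine_op m n u w)
  = affine_op m n (affine_op m n v u) (affine_op m n v w).
Hypothesis nondeg : forall w, exists x a b, n (x, a) w != n (x, b) w.

(** At fibre coordinates 0 and 1 over [w], the cycle identity equates two affine maps. Their linear
    parts agree, and dividing the constant parts by them gives the identity. *)
Lemma affine_cocycle u v w :
  n u w + (m u.1 w)^-1 * n (translate 1 (Gm u.1) v) (translate 1 (Gm u.1) w)
  = n v w + (m v.1 w)^-1 * n (translate 1 (Gm v.1) u) (translate 1 (Gm v.1) w).
Proof.
have /(congr1 snd)/= C0 := cyc (u, 0) (v, 0) (w, 0).
have /(congr1 snd)/= C1 := cyc (u, 0) (v, 0) (w, 1).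
have m0 := m_neq0.
move: C0 C1; set a := m (v.1 + 1) _; set b := m (u.1 + 1) _.
set n1 := n (translate _ _ v) _; set n2 := n (translate _ _ u) _ => C0 C1.
have ab : a * m u.1 w = b * m v.1 w.
  transitivity (a * (m u.1 w * (1 + n u w) + n1)
    - a * (m u.1 w * (0 + n u w) + n1)).
    by ring.
  by rewrite C0 C1; ring.
have a0 : a != 0 := m0 _ _.
have bE : b = a * m u.1 w / m v.1 w by rewrite ab mulfK.
have E : a * m u.1 w != 0 by rewrite mulf_neq0.
apply: (mulfI E); move: C0; rewrite bE !add0r => C0.
transitivity (a * (m u.1 w * n u w + n1)); first by field.
by rewrite C0; field.
Qed.

Lemma affine_classification :
  (exists (Phi1 : 'F_q -> 'F_r) (Phi2 : 'F_p -> 'F_r),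
      cond1 Phi1 Phi2 /\ op_isomorphic (affine_op m n) (op1 Gam0 Phi1 Phi2)) \/
  (exists xi c : 'F_p -> 'F_r,
      cond2 Gam0 xi c /\ op_isomorphic (affine_op m n) (op2 Gam0 xi x0 c)).
Proof.
have q0 : q%:R != 0 :> 'F_r.
  by rewrite Fp_natr_eq0 // dvdn_prime2 // eq_sym; apply/eqP.
(* q times the deviation of [n v w] from its mean over the second coordinate of [v]. In the
   difference of two cocycle identities whose points share a first coordinate, the terms
   [n (x, 0) w] cancel, so [D] scales by [m]. *)
pose D (v w : Y) := \sum_b (n v w - n (v.1, b) w).
have nD x a b w :
    n (translate 1 (Gm x) a) (translate 1 (Gm x) w)
    - n (translate 1 (Gm x) (a.1, b)) (translate 1 (Gm x) w)
    = m x w * (n a w - n (a.1, b) w).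
  have E1 := affine_cocycle (x, 0) a w.
  have E2 := affine_cocycle (x, 0) (a.1, b) w.
  have mx := m_neq0 x w; move: E1 E2 => /= E1 E2.
  apply: (mulfI (invr_neq0 mx)); rewrite mulKf // mulrBr.
  set A := _^-1 * _ in E1 *; set B := _^-1 * _ in E2 *.
  have -> : A - B = (n (x, 0) w + A) - (n (x, 0) w + B) by ring.
  by rewrite E1 E2; ring.
have DE x v w : D (translate 1 (Gm x) v) (translate 1 (Gm x) w) = m x w * D v w.
  rewrite /D (reindex_inj (addIr (Gm x v.1))) mulr_sumr.
  by apply: eq_bigr => b _; rewrite -nD.
have Dnz w : exists v, D v w != 0.
  have [x [a [b nab]]] := nondeg w.
  have [D0|D0] := eqVneq (D (x, a) w) 0; last by exists (x, a).
  exists (x, b); apply: contraNneq nab => D1.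
  have : D (x, a) w - D (x, b) w = q%:R * (n (x, a) w - n (x, b) w).
    rewrite /D -sumrB /= (eq_bigr (fun=> n (x, a) w - n (x, b) w)).
      by rewrite sumr_const card_Fp // mulr_natl.
    by move=> c _; ring.
  move/eqP; rewrite D0 D1 subrr eq_sym mulf_eq0 (negPf q0) subr_eq0.
  exact.
have twist i f : f \in KG -> exists mu : Y -> 'F_r, forall u w,
    D (translate i f u) (translate i f w) = mu w * D u w.
  move: i f; apply: semidirect_ind => //.
  - exists (fun=> 1) => u w; rewrite mul1r.
    have t0 t : translate 0 0 t = t :> Y.
      by case: t => y b; rewrite /translate /= ffunE !addr0.
    by rewrite !t0.
  - move=> i f j h [mf fE] [mh hE].
    exists (fun w => mf (translate j h w) * mh w).
    by move=> u w; rewrite -!translate_comp fE hE mulrA.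
  by move=> x; exists (m x) => u w; apply: DE.
have [xi [g [xiR g0 xi1 eqvD]]] :=
  multiplier_character q_prime Gam0_x0 Dnz twist.
(* As some [D v w] is nonzero, comparing its two scaling laws shows that [m] is chi up to the
   rescaling [g]. *)
have mE x w : m x w = chi xi w.1 (Gm x) * g (translate 1 (Gm x) w) / g w.
  have [v Dv] := Dnz w; apply: (mulIf Dv); rewrite -DE.
  have := eqvD 1 (Gm x) v w (K_Gam _ x) => /(canRL (divfK (g0 _))) ->.
  by rewrite mulrAC; field.
pose N u w := n u w / g w.
have cycN u v w :
    N u w + (chi xi w.1 (Gm u.1))^-1
            * N (translate 1 (Gm u.1) v) (translate 1 (Gm u.1) w)
    = N v w + (chi xi w.1 (Gm v.1))^-1
            * N (translate 1 (Gm v.1) u) (translate 1 (Gm v.1) w).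
  have := affine_cocycle u v w; rewrite !mE => C.
  have chi0 := chi_neq0 xiR; rewrite /N; apply: (mulIf (g0 w)).
  move: C; set n1 := n (translate _ _ v) _.
  set n2 := n (translate _ _ u) _ => C.
  transitivity (n u w
    + (chi xi w.1 (Gm u.1) * g (translate 1 (Gm u.1) w) / g w)^-1 * n1).
    by field; rewrite !g0 !chi0.
  by rewrite C; field; rewrite !g0 !chi0.
have [H [Psi [eqv NE]]] := coboundary_decomposition p_prime q_prime r_prime
  neq_pq neq_pr neq_qr xiR cycN.
have isoN : op_isomorphic (affine_op m n) (bundle_op Gam0 xi Psi).
  exists (fun v => (v.1, v.2 / g v.1 + H v.1)); split.
    exists (fun v => (v.1, (v.2 - H v.1) * g v.1)) => -[w t] /=.
      by rewrite addrK divfK.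
    by rewrite mulfK // subrK.
  move=> [u s] [w t]; rewrite /affine_op /bundle_op /=; congr (_, _).
  have PE : Psi u w = n u w / g w
      + ((chi xi w.1 (Gm u.1))^-1 * H (translate 1 (Gm u.1) w) - H w).
    by rewrite -/(N u w) NE subrK.
  by rewrite PE mE; field; rewrite !g0 chi_neq0.
(* The coboundary of [H] depends on [u] only through its first coordinate, so [Psi] inherits the
   dependence of [n] on the second one. *)
have ndPsi : exists x a b w, Psi (x, a) w != Psi (x, b) w.
  have [x [a [b nab]]] := nondeg (0, 0).
  exists x, a, b, (0, 0); apply: contraNneq nab => E.
  have : N (x, a) (0, 0) = N (x, b) (0, 0) by rewrite !NE E.
  by move/(mulIf (invr_neq0 (g0 _))) ->.
have [[P1 [P2 [cnd iso]]]|[xi' [c [cnd iso]]]] :=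
  bundle_classification xiR xi1 eqv ndPsi.
  by left; exists P1, P2; split=> //; apply: op_isomorphic_trans iso.
by right; exists xi', c; split=> //; apply: op_isomorphic_trans iso.
Qed.

End Affine.

End Classification.

(** * Affine coordinates on a cycle set *)

Section PrimeOrbits.

Variables (T : finType) (S : {set T}) (G : {group {perm T}}).
Hypothesis GS : forall g z, g \in G -> (g z \in S) = (z \in S).

Lemma prime_uniform_orbit z : prime #|S| ->
  (forall y, y \in S -> #|orbit 'P G y| = #|orbit 'P G z|) ->
  z \in S -> #|orbit 'P G z| != 1%N -> orbit 'P G z = S.
Proof.
move=> Sp unif zS Oz.
have acts : [acts G, on S | 'P] by apply/actsP=> g gG y; rewrite /= apermE GS.
have : (#|orbit 'P G z| %| #|S|)%N.
  apply/dvdnP; exists #|[set orbit 'P G y | y in S]|.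
  apply: card_uniform_partition (orbit_partition acts) => _ /imsetP[y yS ->].
  exact: unif.
move=> /(prime_nt_dvdP Sp Oz) E.
apply/eqP; rewrite eqEcard E leqnn andbT.
by apply/subsetP=> _ /orbitP[g gG <-]; rewrite /= apermE GS.
Qed.

End PrimeOrbits.

Section Coordinates.

Variables p q r : nat.
Hypotheses (p_prime : prime p) (q_prime : prime q) (r_prime : prime r).
Variables (Gam0 : 'F_p -> 'F_q) (x0 : 'F_p).
Hypothesis Gam0_nprop : ~ proportional_to_character Gam0.
Hypothesis Gam0_x0 : Gam0 (- x0) = 1.

Local Notation Y := ('F_p * 'F_q)%type.
Local Notation Gm := (Gam Gam0).

Variables (X : finType) (op : X -> X -> X) (prY : X -> Y) (sec : Y -> X).
Hypothesis op_inj : forall x, injective (op x).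
Hypothesis op_cyc : forall x y z, op (op x y) (op x z) = op (op y x) (op y z).
Hypothesis op_tr : transitive_family op.
Hypothesis cardX : #|X| = (p * q * r)%N.
Hypothesis secK : cancel sec prY.
Hypothesis prY_op : forall x y,
  prY (op x y) = translate 1%R (Gm (prY x).1) (prY y).
Hypothesis prY_eq : forall x y, prY x = prY y <-> op x =1 op y.

Local Open Scope group_scope.

Let fib w := [set z | prY z == w].
Let lam (u : Y) : {perm X} := perm (@op_inj (sec u)).
Let dot (u w : Y) : Y := translate 1%R (Gm u.1) w.

Lemma lamE u z : lam u z = op (sec u) z. Proof. exact: permE. Qed.

Lemma op_lam x : op x =1 lam (prY x).
Proof.
by move=> z; rewrite lamE; apply: (proj1 (prY_eq _ _)); rewrite secK. Qed.

Lemma prY_lam u z : prY (lam u z) = dot u (prY z).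
Proof. by rewrite lamE prY_op secK. Qed.

(** Each [lam u] embeds fibres into fibres, and the base action is transitive, so all fibres have
    the same size. *)
Lemma card_fib w : #|fib w| = r.
Proof.
have cst : forall w w', #|fib w| = #|fib w'|.
  apply: (transitive_nondecreasing (translate_transitive q_prime
    Gam0_nprop Gam0_x0)) => x v.
  rewrite -(card_imset _ (@perm_inj _ (lam (x, 0%R)))); apply: subset_leq_card.
  apply/subsetP=> _ /imsetP[z + ->]; rewrite !inE => /eqP <-.
  by rewrite prY_lam.
have : #|X| = (\sum_(v : Y) #|fib w|)%N.
  rewrite -[LHS]sum1_card (partition_big prY xpredT) //=; apply: eq_bigr => v _.
  by rewrite sum1_card (cst w v); apply: eq_card => z; rewrite inE.
rewrite cardX sum_nat_const card_prod !card_Fp // => /eqP.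
by rewrite eqn_pmul2l ?muln_gt0 ?prime_gt0 // => /eqP.
Qed.

Lemma lam_cyc u v : lam u * lam (dot u v) = lam v * lam (dot v u).
Proof.
apply/permP=> z; rewrite !permM.
by have := op_cyc (sec u) (sec v) z; rewrite !op_lam !prY_lam !secK.
Qed.

Let kap y b b' : {perm X} := lam (y, b) * (lam (y, b'))^-1.

(** By [lam_cyc], [lam (dot u (y, c))] equals [lam (y, c)] multiplied on both sides by factors that
    do not depend on [c]; the right-hand one cancels in [kap]. *)
Lemma kapJ y b b' u :
  kap y b b' ^ lam u = kap (y + 1)%R (b + Gm u.1 y)%R (b' + Gm u.1 y)%R.
Proof.
have E c : lam (y + 1, c + Gm u.1 y)%R =
    (lam u)^-1 * lam (y, c) * lam (dot (y, 0%R) u).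
  by rewrite -mulgA (lam_cyc (y, c) u) mulKg.
by rewrite /kap !E !invMg invgK conjgE !mulgA mulgK.
Qed.

Let N0 := <<[set kap t.1.1 t.1.2 t.2 | t : 'F_p * 'F_q * 'F_q]>>.

Lemma kap_N0 y b b' : kap y b b' \in N0.
Proof. by apply: mem_gen; apply/imsetP; exists (y, b, b'). Qed.

Lemma N0_ind (P : {perm X} -> Prop) : P 1 ->
  (forall g h, P g -> P h -> P (g * h)) -> (forall y b b', P (kap y b b')) ->
  forall g, g \in N0 -> P g.
Proof.
move=> P1 PM Pk _ /gen_prodgP[n [c cA ->]]; apply: (big_ind P) => // i _.
by have /imsetP[t _ ->] := cA i.
Qed.

Lemma N0J g u : g \in N0 -> g ^ lam u \in N0.
Proof.
move: g; apply: N0_ind => [|g h gN hN|y b b'].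
- by rewrite conj1g group1.
- by rewrite conjMg groupM.
- by rewrite kapJ kap_N0.
Qed.

(* Conjugation by lam (x, a) on the kap y b b' does not depend on a. *)
Lemma N0_abelian : abelian N0.
Proof.
rewrite /N0 abelian_gen; apply/centsP => _ /imsetP[[[x a] a'] _ ->].
move=> _ /imsetP[[[y b] b'] _ ->] /=; apply/commute_sym/commgP/conjg_fixP.
by rewrite {2}/kap conjgM kapJ -(kapJ y b b' (x, a')) conjgK.
Qed.

Lemma prY_N0 g z : g \in N0 -> prY (g z) = prY z.
Proof.
move=> gN; move: g gN z; apply: N0_ind => [z|g h gE hE z|y b b' z].
- by rewrite perm1.
- by rewrite permM hE gE.
- rewrite /kap permM; apply: (@translate_inj _ _ 1%R (Gm y)).
  have := prY_lam (y, b') ((lam (y, b'))^-1 (lam (y, b) z)).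
  by rewrite permKV prY_lam => /esym.
Qed.

(** The maps [op x] normalize N0 and are transitive, so all N0-orbits have one size, which divides
    r. Size 1 would make N0 trivial and [lam (0, 0) = lam (0, 1)], although the retraction separates
    these points. *)
Lemma N0_orbit z : orbit 'P N0 z = fib (prY z).
Proof.
have cst : forall y z, #|orbit 'P N0 y| = #|orbit 'P N0 z|.
  apply: (transitive_nondecreasing op_tr) => x y.
  rewrite -(card_imset _ (@op_inj x)); apply: subset_leq_card.
  apply/subsetP=> _ /imsetP[_ /orbitP[g gN <-] ->]; apply/orbitP.
  exists (g ^ lam (prY x)); first exact: N0J.
  by rewrite /= !apermE !op_lam -!permM -conjgC.
apply: prime_uniform_orbit; rewrite ?card_fib ?inE //.
  by move=> g y gN; rewrite !inE prY_N0.
apply/eqP => O1.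
have fix1 g y : g \in N0 -> g y = y.
  move=> gN; have := mem_orbit 'P y gN; rewrite /= apermE.
  by rewrite card_orbit1 ?(cst _ z) // inE => /eqP.
have /prY_eq : op (sec (0, 0))%R =1 op (sec (0, 1))%R.
  move=> y; rewrite -!lamE -{2}[y](fix1 (kap 0 0 1)%R) ?kap_N0 //.
  by rewrite /kap permM permKV.
by rewrite !secK => -[] /eqP; rewrite eq_sym (negPf (oner_neq0 _)).
Qed.

Lemma N0_moves w : exists g, g \in N0 /\ g (sec w) != sec w.
Proof.
have [g /andP[gN gw]|noG] :=
  pickP [pred g | (g \in N0) && (g (sec w) != sec w)].
  by exists g.
have : (#|orbit 'P N0 (sec w)| <= 1)%N.
  rewrite -(cards1 (sec w)); apply/subset_leq_card/subsetP.
  move=> _ /orbitP[g gN <-].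
  by have := noG g; rewrite /= gN inE apermE /= => /negbFE.
by rewrite N0_orbit card_fib leqNgt prime_gt1.
Qed.

(** N0 is abelian and transitive on the fibre, so all cycles of [g] there have the same length,
    which divides the prime r and is not 1. *)
Lemma N0_porbit g w z : g \in N0 -> g (sec w) != sec w -> prY z = w ->
  porbit g z = fib w.
Proof.
move=> gN gw zw; rewrite porbitE.
have gXN h : h \in <[g]> -> h \in N0 by apply/subsetP; rewrite cycle_subG.
have le y y' : y' \in orbit 'P N0 y ->
    (#|orbit 'P <[g]> y| <= #|orbit 'P <[g]> y'|)%N.
  case/orbitP=> h hN <-; rewrite /= apermE -(card_imset _ (@perm_inj _ h)).
  apply/subset_leq_card/subsetP => _ /imsetP[_ /orbitP[k kg <-] ->].
  apply/orbitP; exists k => //; rewrite /= !apermE -!permM.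
  by rewrite (centsP N0_abelian h hN k (gXN k kg)).
have unif y y' : prY y = w -> prY y' = w ->
    #|orbit 'P <[g]> y| = #|orbit 'P <[g]> y'|.
  move=> yw y'w; apply/eqP; rewrite eqn_leq !le // N0_orbit inE yw y'w //.
apply: prime_uniform_orbit; rewrite ?card_fib ?inE ?zw //.
- by move=> h y /gXN hN; rewrite !inE prY_N0.
- by move=> y; rewrite inE => /eqP yw; apply: unif.
rewrite (unif z (sec w)) //; apply: contraNneq gw => O1.
have := mem_orbit 'P (sec w) (cycle_id g).
by rewrite card_orbit1 // inE /= apermE.
Qed.

(* A generator nu w of the action of N0 on the fibre over w identifies this
   fibre with 'F_r. Elements of N0 act as translations since N0 is abelian, and
   the maps lam u act affinely since they normalize N0. *)
Lemma affine_coordinates : exists (m : 'F_p -> Y -> 'F_r) (n : Y -> Y -> 'F_r),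
  [/\ forall x w, m x w != 0%R,
      forall w, exists x a b, n (x, a) w != n (x, b) w
    & op_isomorphic op (affine_op Gam0 m n)].
Proof.
have [nu nuP] := fin_all_exists N0_moves.
have nuN w : nu w \in N0 by case: (nuP w).
have nu1 w : nu w (sec w) != sec w by case: (nuP w).
pose pt (w : Y) (t : 'F_r) : X := (nu w ^+ t) (sec w).
have pr_pt w t : prY (pt w t) = w by rewrite prY_N0 ?groupX // secK.
have pt_nat w k : (nu w ^+ k) (sec w) = pt w (k%:R)%R.
  have per1 : (nu w ^+ r) (sec w) = sec w.
    rewrite permX -(card_fib w) -(N0_porbit (nuN w) (nu1 w) (secK w)).
    exact: iter_porbit.
  have per j : (nu w ^+ (r * j)) (sec w) = sec w.
    elim: j => [|j IH]; first by rewrite muln0 perm1.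
    by rewrite mulnS expgD permM per1.
  rewrite /pt val_Fp_nat // {1}(divn_eq k r) mulnC expgD permM per //.
have pt_surj z : exists t, pt (prY z) t == z.
  have : z \in fib (prY z) by rewrite inE.
  rewrite -(N0_porbit (nuN _) (nu1 _) (secK (prY z))) => /porbitP[k zE].
  by exists (k%:R)%R; rewrite -pt_nat -zE.
pose co z := (prY z, xchoose (pt_surj z)).
have coK z : pt (co z).1 (co z).2 = z by apply/eqP/(xchooseP (pt_surj z)).
have coI : injective co by apply: (can_inj (g := fun v => pt v.1 v.2)) coK.
have coB : bijective co.
  by apply: inj_card_bij coI _; rewrite cardX !card_prod !card_Fp.
have ptK v : co (pt v.1 v.2) = v.
  have [co' _ co'K] := coB; rewrite -[v]co'K coK //.
have pt_inj w t t' : pt w t = pt w t' -> t = t'.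
  by move=> E; have := congr1 co E; rewrite (ptK (w, t)) (ptK (w, t')) => -[].
have ptP z w : prY z = w -> exists t, z = pt w t.
  by move=> <-; exists (co z).2; rewrite coK.
have N0_trans g w : g \in N0 -> exists j, forall t, g (pt w t) = pt w (t + j)%R.
  move=> gN; have [j gE] : exists j, g (sec w) = pt w j.
    by apply: ptP; rewrite prY_N0 // secK.
  exists j => t; rewrite {1}/pt -permM -(centsP N0_abelian g gN) ?groupX //.
  by rewrite permM gE {1}/pt -permM -expgD pt_nat natrD !natr_Zp addrC.
(* Conjugation by [lam u] turns [nu w] into a translation by some [j], so [t] steps from [sec w]
   become [t] steps of length [j] from its image [i]. *)
have lam_affine (uw : Y * Y) : exists JI : 'F_r * 'F_r, JI.1 != 0%R /\
    forall t, lam uw.1 (pt uw.2 t) = pt (dot uw.1 uw.2) (JI.1 * t + JI.2)%R.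
  case: uw => u w /=.
  have [i iE] : exists i, lam u (sec w) = pt (dot u w) i.
    by apply: ptP; rewrite prY_lam secK.
  have gN := N0J u (nuN w); set g := nu w ^ lam u in gN.
  have [j jE] := N0_trans g (dot u w) gN.
  exists (j, i) => /=; split=> [|t].
    apply: contraNneq (nu1 w) => j0; apply/eqP/(@perm_inj _ (lam u)).
    by rewrite -permM conjgC permM -/g iE jE j0 addr0.
  rewrite {1}/pt -permM conjgC permM conjXg -/g iE.
  rewrite -[t in RHS]natr_Zp mulr_natr addrC.
  elim: (nat_of_ord t) => [|k IH]; first by rewrite perm1 mulr0n addr0.
  by rewrite expgSr permM IH jE -addrA -mulrSr.
have [JI JIP] := fin_all_exists lam_affine.
pose J u w := (JI (u, w)).1; pose I u w := (JI (u, w)).2.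
have J0 u w : J u w != 0%R by case: (JIP (u, w)).
have lam_pt u w t : lam u (pt w t) = pt (dot u w) (J u w * t + I u w)%R.
  by case: (JIP (u, w)).
(* [lam (x, a)] and [lam (x, b)] differ by [kap x a b], a translation on each fibre, so their linear
   parts agree. *)
have Jcst x a b w : J (x, a) w = J (x, b) w.
  have [k kE] := N0_trans _ w (kap_N0 x a b).
  have E t :
      (J (x, a) w * t + I (x, a) w = J (x, b) w * (t + k) + I (x, b) w)%R.
    apply: (pt_inj (dot (x, a) w)); rewrite -lam_pt -(lam_pt (x, b)) -kE.
    by rewrite /kap permM permKV.
  have := E 1%R; have := E 0%R; rewrite mulr0 add0r => -> /eqP.
  rewrite -subr_eq0 => /eqP E1.
  by apply/eqP; rewrite -subr_eq0 -E1; apply/eqP; ring.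
exists (fun x w => J (x, 0%R) w), (fun u w => I u w / J u w)%R; split=> //.
  move=> w; have [/existsP[x /existsP[a /existsP[b nab]]]|] :=
    boolP [exists x, exists a, exists b,
      (I (x, a) w / J (x, a) w != I (x, b) w / J (x, b) w)%R].
    by exists x, a, b.
  move=> /existsPn noE; case/eqP: (nu1 w).
  (* Without dependence on the second coordinate, each [kap] and hence all of N0 would fix [sec w],
     but [nu w] moves it. *)
  have kfix x a b : kap x a b (sec w) = sec w.
    have := noE x => /existsPn/(_ a)/existsPn/(_ b)/negPn/eqP.
    rewrite (Jcst x b a) => /(mulIf (invr_neq0 (J0 _ _))) IE.
    apply: (@perm_inj _ (lam (x, b))); rewrite /kap permM permKV.
    have -> : sec w = pt w 0%R by rewrite -(pt_nat w 0) perm1.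
    by rewrite !lam_pt IE (Jcst x a b).
  move: (nu w) (nuN w); apply: N0_ind => [|g h gE hE|//]; first exact: perm1.
  by rewrite permM gE.
exists co; split=> // x y; rewrite op_lam -{1}(coK y) lam_pt.
rewrite (ptK (_, _)) /affine_op /=; congr (_, _).
have -> : J (prY x) (prY y) = J ((prY x).1, 0%R) (prY y).
  by rewrite [prY x]surjective_pairing; apply: Jcst.
by rewrite mulrDr mulrCA divff ?mulr1.
Qed.

End Coordinates.

Theorem theorem4p10 (p q r : nat)
  (p_prime : prime p) (q_prime : prime q) (r_prime : prime r)
  (neq_pq : p <> q) (neq_pr : p <> r) (neq_qr : q <> r)
  (Gam0 : 'F_p -> 'F_q) (x0 : 'F_p)
  (Gam0_neq0 : exists x, Gam0 x <> 0)
  (Gam0_nprop : ~ proportional_to_character Gam0)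
  (Gam0_x0 : Gam0 (- x0) = 1) :
  (forall X : cycleSet,
      indecomposable (@cs_op X) -> has_mpl X 3 -> #|X| = (p * q * r)%N ->
      op_isomorphic (@cs_op (ret X)) (ext_op Gam0) ->
      (exists (Phi1 : 'F_q -> 'F_r) (Phi2 : 'F_p -> 'F_r),
          cond1 Phi1 Phi2 /\ op_isomorphic (@cs_op X) (op1 Gam0 Phi1 Phi2))
      \/
      (exists xi c : 'F_p -> 'F_r,
          cond2 Gam0 xi c /\ op_isomorphic (@cs_op X) (op2 Gam0 xi x0 c)))
  /\
  (forall (Phi1 : 'F_q -> 'F_r) (Phi2 : 'F_p -> 'F_r),
      cond1 Phi1 Phi2 ->
      is_cycle_set (op1 Gam0 Phi1 Phi2)
      /\ indecomposable (op1 Gam0 Phi1 Phi2))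
  /\
  (forall xi c : 'F_p -> 'F_r,
      cond2 Gam0 xi c ->
      is_cycle_set (op2 Gam0 xi x0 c)
      /\ indecomposable (op2 Gam0 xi x0 c)).
Proof.
split; last split.
- move=> X ind _ cardX [phi [[psi phiK psiK] phiM]].
  have [cyc bij _] := cs_axiom X.
  have inj x : injective (@cs_op X x) by apply: bij_inj.
  pose prY x := phi (\pi_(ret_type X) x)%qT.
  have secK : cancel (fun w => repr (psi w)) prY.
    by move=> w; rewrite /prY reprK psiK.
  have prY_op x y : prY (cs_op x y) = translate 1 (Gam Gam0 (prY x).1) (prY y).
    by rewrite -ext_opE -phiM /= ret_opE.
  have prY_eq x y : prY x = prY y <-> cs_op x =1 cs_op y.
    rewrite -ret_piP; split=> [/(can_inj phiK) //|E]; exact: (congr1 phi E).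
  have [m [n [m0 nondeg iso]]] := affine_coordinates p_prime q_prime r_prime
    Gam0_nprop Gam0_x0 inj cyc (indecomposable_transitive inj ind) cardX
    secK prY_op prY_eq.
  pose opA := affine_op Gam0 m n.
  have cycA u v w : opA (opA u v) (opA u w) = opA (opA v u) (opA v w).
    have [f [[g _ gK] fM]] := iso.
    by rewrite /opA -[u]gK -[v]gK -[w]gK -!fM cyc.
  have [[P1 [P2 [cnd iso']]]|[xi [c [cnd iso']]]] :=
    affine_classification p_prime q_prime r_prime neq_pq neq_pr neq_qr
      Gam0_nprop Gam0_x0 m0 cycA nondeg.
    by left; exists P1, P2; split=> //; apply: op_isomorphic_trans iso'.
  by right; exists xi, c; split=> //; apply: op_isomorphic_trans iso'.
- move=> Phi1 Phi2 cnd; have E := op1_bundle Gam0 Phi1 Phi2.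
  have eqv : equivariant Gam0 (fun=> 1) (Psi1 Phi1 Phi2).
    exact: Psi1_equivariant.
  have xiR : xi_roots q (fun _ : 'F_p => 1 : 'F_r) by apply: xi_roots_1.
  split; first exact: is_cycle_set_ext E (bundle_op_cycle_set xiR eqv).
  apply: indecomposable_ext E _.
  apply: bundle_op_indecomposable Gam0_x0 eqv _ => //.
  exact: Psi1_neq0.
- move=> xi c [xiR _ cN]; have E := op2_bundle Gam0 x0 xi c.
  have eqv : equivariant Gam0 xi (Psi2 Gam0 x0 xi c) by apply: Psi2_equivariant.
  split; first exact: is_cycle_set_ext E (bundle_op_cycle_set xiR eqv).
  apply: indecomposable_ext E _.
  apply: bundle_op_indecomposable Gam0_x0 eqv _ => //.
  exact: Psi2_neq0.
Qed.
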